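(* Let $R(\lambda)=D(\lambda)+C(\lambda)A(\lambda)^{-1}B(\lambda)\in\mathbb{C}(\lambda)^{p\times p}$ be a regular rational matrix, where $A(\lambda)\in\mathbb{C}[\lambda]^{n\times n}$ is regular and $B(\lambda)\in\mathbb{C}[\lambda]^{n\times p}$, $C(\lambda)\in\mathbb{C}[\lambda]^{p\times n}$, $D(\lambda)\in\mathbb{C}[\lambda]^{p\times p}$. Assume that $\lambda_0\in\mathbb{C}$ is a simple eigenvalue (i.e. simple zero) of $R(\lambda)$ with $\det A(\lambda_0)\neq0$. Let $x$ and $y$ be, respectively, right and left eigenvectors of $R(\lambda)$ associated with $\lambda_0$. Then the structured absolute condition number $\kappa_S(\lambda_0)$ (with respect to nonnegative weights $a_i,b_i,c_i,d_i$) is given by $$\kappa_S(\lambda_0)=\frac{1}{|y^TR'(\lambda_0)x|}\begin{bmatrix}\|y^TC(\lambda_0)A(\lambda_0)^{-1}\|_2&\|y\|_2\end{bmatrix}\,S(\lambda_0)\,\begin{bmatrix}\|A(\lambda_0)^{-1}B(\lambda_0)x\|_2\\ \|x\|_2\end{bmatrix},$$ where $$S(\lambda):=\begin{bmatrix}\sum_{i=0}^{k_A}a_i|\lambda|^i&\sum_{i=0}^{k_B}b_i|\lambda|^i\\ \sum_{i=0}^{k_C}c_i|\lambda|^i&\sum_{i=0}^{k_D}d_i|\lambda|^i\end{bmatrix}.$$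
   Context: A square polynomial or rational matrix is regular if its determinant is not identically zero. For every regular rational matrix $R(\lambda)\in\mathbb{C}(\lambda)^{p\times p}$ and $\lambda_0\in\mathbb{C}$ there are rational matrices $G_1,G_2$ invertible at $\lambda_0$ (no pole at $\lambda_0$ and nonzero determinant there) with $G_1RG_2=\mathrm{diag}((\lambda-\lambda_0)^{\nu_1},\dots,(\lambda-\lambda_0)^{\nu_p})$, with uniquely determined integers $\nu_1\le\dots\le\nu_p$. $\lambda_0$ is a zero (eigenvalue) of $R$ if some $\nu_i>0$; it is simple if exactly one $\nu_i$ is positive and it equals $1$. Since $\det A(\lambda_0)\ne0$, $\lambda_0$ is not a pole of $R(\lambda)$, and right (left) eigenvectors of $R(\lambda)$ associated with $\lambda_0$ are nonzero vectors $x\in\mathbb{C}^p$ (resp. $y\in\mathbb{C}^p$) with $R(\lambda_0)x=0$ (resp. $y^TR(\lambda_0)=0$). Definition of $\kappa_S$. Let $P(\lambda)=\begin{bmatrix}-A(\lambda)&B(\lambda)\\ C(\lambda)&D(\lambda)\end{bmatrix}$, whose transfer function matrix is $R(\lambda)$. Write $A(\lambda)=\sum_{i=0}^{k_A}A_i\lambda^i$, $B(\lambda)=\sum_{i=0}^{k_B}B_i\lambda^i$, $C(\lambda)=\sum_{i=0}^{k_C}C_i\lambda^i$, $D(\lambda)=\sum_{i=0}^{k_D}D_i\lambda^i$, and consider perturbations $\Delta A(\lambda)=\sum_{i=0}^{k_A}\Delta A_i\lambda^i$, $\Delta B(\lambda)=\sum_{i=0}^{k_B}\Delta B_i\lambda^i$,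 $\Delta C(\lambda)=\sum_{i=0}^{k_C}\Delta C_i\lambda^i$, $\Delta D(\lambda)=\sum_{i=0}^{k_D}\Delta D_i\lambda^i$ with complex matrix coefficients of the same sizes, and $\Delta P(\lambda)=\begin{bmatrix}-\Delta A(\lambda)&\Delta B(\lambda)\\ \Delta C(\lambda)&\Delta D(\lambda)\end{bmatrix}$. Given nonnegative weights $a_i,b_i,c_i,d_i$ and $v$ a right eigenvector of $P(\lambda)$ associated with $\lambda_0$, $$\kappa_S(\lambda_0):=\lim_{\epsilon\to0}\sup\Big\{\frac{|\Delta\lambda_0|}{\epsilon}:\ [P(\lambda_0+\Delta\lambda_0)+\epsilon\Delta P(\lambda_0+\Delta\lambda_0)][v+\epsilon\Delta v]=0,\ \|\Delta A_i\|_2\le a_i,\|\Delta B_i\|_2\le b_i,\|\Delta C_i\|_2\le c_i,\|\Delta D_i\|_2\le d_i\Big\},$$ where $\epsilon>0$ and $\lambda_0+\Delta\lambda_0$ denotes the eigenvalue of $P(\lambda)+\epsilon\Delta P(\lambda)$ that arises from perturbing the simple eigenvalue $\lambda_0$ of $P(\lambda)$, i.e. the unique eigenvalue (for small $\epsilon$) in a fixed small disc around $\lambda_0$ containing no other eigenvalue of $P(\lambda)$, depending analytically on $\epsilon$ and equal to $\lambda_0$ at $\epsilon=0$. *)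

(* Defs.v *)
From HB Require Import structures.
From mathcomp Require Import all_boot all_order all_algebra generic_quotient.
From mathcomp Require Export fraction complex.
From mathcomp Require Import all_classical all_reals all_analysis.
Import Order.TTheory GRing.Theory Num.Theory.
Import numFieldNormedType.Exports.

Set Implicit Arguments.
Unset Strict Implicit.
Unset Printing Implicit Defensive.

Local Open Scope classical_set_scope.
Local Open Scope ring_scope.
Local Open Scope complex_scope.

Local Notation "x %:F" := (@FracField.tofrac _ x).

(* The field C(lambda); the complex numbers are K[i] for K : realType. *)
Notation ratfun F := {fraction {poly F}}.

(** Rational functions: poles, values, derivatives *)

Section RationalFunctions.
Context {F : fieldType}.
Implicit Types (f : ratfun F) (z : F).

(* repr f is an arbitrary, possibly non-reduced, representative of f, so the
   common factors have to be cancelled before evaluating. *)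
Definition rf_num f : {poly F} :=
  let: (u, w) := frac (repr f) in u %/ gcdp u w.

Definition rf_den f : {poly F} :=
  let: (u, w) := frac (repr f) in w %/ gcdp u w.

Definition pole f z : bool := root (rf_den f) z.

(* Only meaningful when z is not a pole of f (it is 0 otherwise). *)
Definition rf_eval f z : F := (rf_num f).[z] / (rf_den f).[z].

Definition rf_deriv f : ratfun F :=
  ((rf_num f)^`() * rf_den f - rf_num f * (rf_den f)^`())%:F
    / (rf_den f ^+ 2)%:F.

End RationalFunctions.

(** Polynomial and rational matrices *)

Section Matrices.
Context {F : fieldType}.

Definition pm_eval m n (M : 'M[{poly F}]_(m, n)) (z : F) : 'M[F]_(m, n) :=
  map_mx (fun q : {poly F} => q.[z]) M.

Definition pm_coef m n (M : 'M[{poly F}]_(m, n)) (i : nat) : 'M[F]_(m, n) :=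
  map_mx (fun q : {poly F} => q`_i) M.

(* M can be written as \sum_(i <= k) M_i lambda^i; M_k = 0 is allowed. *)
Definition has_grade (k : nat) m n (M : 'M[{poly F}]_(m, n)) : Prop :=
  forall i j, (size (M i j) <= k.+1)%N.

Definition pm_ratmx m n (M : 'M[{poly F}]_(m, n)) : 'M[ratfun F]_(m, n) :=
  map_mx (fun q : {poly F} => q%:F) M.

Definition rm_eval m n (M : 'M[ratfun F]_(m, n)) (z : F) : 'M[F]_(m, n) :=
  map_mx (fun f => rf_eval f z) M.

Definition rm_deriv m n (M : 'M[ratfun F]_(m, n)) : 'M[ratfun F]_(m, n) :=
  map_mx rf_deriv M.

Definition regular p (M : 'M[ratfun F]_p) : Prop := \det M != 0.

Definition invertible_at p (G : 'M[ratfun F]_p) (z : F) : Prop :=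
  (forall i j, ~~ pole (G i j) z) /\ \det (rm_eval G z) != 0.

Definition local_smith_exponents p (M : 'M[ratfun F]_p) (z : F)
    (nu : 'I_p -> int) : Prop :=
  (forall i j : 'I_p, (i <= j)%N -> nu i <= nu j) /\
  exists G1 G2 : 'M[ratfun F]_p,
    [/\ invertible_at G1 z, invertible_at G2 z &
        G1 *m M *m G2 = diag_mx (\row_i (('X - z%:P)%:F ^ nu i))].

Definition zero_of p (M : 'M[ratfun F]_p) (z : F) : Prop :=
  exists2 nu, local_smith_exponents M z nu & exists i, 0 < nu i.

Definition simple_zero_of p (M : 'M[ratfun F]_p) (z : F) : Prop :=
  exists2 nu, local_smith_exponents M z nu &
    exists2 i, nu i = 1 & forall j, 0 < nu j -> j = i.

(* For z not a pole of M. *)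
Definition right_eigenvector p (M : 'M[ratfun F]_p) (z : F) (x : 'cV[F]_p) :
  Prop := x != 0 /\ rm_eval M z *m x = 0.

Definition left_eigenvector p (M : 'M[ratfun F]_p) (z : F) (y : 'cV[F]_p) :
  Prop := y != 0 /\ y^T *m rm_eval M z = 0.

Definition sysmx n p (A : 'M[{poly F}]_n) (B : 'M[{poly F}]_(n, p))
    (C : 'M[{poly F}]_(p, n)) (D : 'M[{poly F}]_p) : 'M[{poly F}]_(n + p) :=
  block_mx (- A) B C D.

Definition transfer n p (A : 'M[{poly F}]_n) (B : 'M[{poly F}]_(n, p))
    (C : 'M[{poly F}]_(p, n)) (D : 'M[{poly F}]_p) : 'M[ratfun F]_p :=
  pm_ratmx D + pm_ratmx C *m invmx (pm_ratmx A) *m pm_ratmx B.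

End Matrices.

Section ConditionNumber.
Context {K : realType}.
Local Notation normc := (@Normc.normc K).

(* Euclidean norm; applied to row and column vectors only. *)
Definition vnorm2 m n (u : 'M[K[i]]_(m, n)) : K :=
  Num.sqrt (\sum_i \sum_j normc (u i j) ^+ 2).

Definition mxnorm2 m n (M : 'M[K[i]]_(m, n)) : K :=
  sup [set vnorm2 (M *m u) | u in [set u : 'cV_n | vnorm2 u <= 1]].

(* dM = \sum_(i <= k) dM_i lambda^i with ||dM_i||_2 <= w_i. *)
Definition admissible k (w : 'I_k.+1 -> K) m n
    (dM : 'M[{poly K[i]}]_(m, n)) : Prop :=
  has_grade k dM /\ forall i : 'I_k.+1, mxnorm2 (pm_coef dM i) <= w i.

Definition isolating_radius m (P : 'M[{poly K[i]}]_m) (z0 : K[i]) (r : K) :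
  Prop :=
  0 < r /\ forall z, normc (z - z0) <= r -> zero_of (pm_ratmx P) z -> z = z0.

Definition unique_zero_in_disc m (Q : 'M[{poly K[i]}]_m) (z0 : K[i]) (r : K)
    (z : K[i]) : Prop :=
  [/\ normc (z - z0) < r, zero_of (pm_ratmx Q) z &
      forall z', normc (z' - z0) < r -> zero_of (pm_ratmx Q) z' -> z' = z].

Section Quotients.
Variables (n p kA kB kC kD : nat).
Variables (A : 'M[{poly K[i]}]_n) (B : 'M[{poly K[i]}]_(n, p)).
Variables (C : 'M[{poly K[i]}]_(p, n)) (D : 'M[{poly K[i]}]_p).
Variables (a : 'I_kA.+1 -> K) (b : 'I_kB.+1 -> K).
Variables (c : 'I_kC.+1 -> K) (d : 'I_kD.+1 -> K).
Variables (z0 : K[i]) (v : 'cV[K[i]]_(n + p)).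

(* The nonvanishing of v + eps * dv makes it an eigenvector: without it,
   dv = - v / eps would turn the equation into a void condition. *)
Definition structured_quotients (r eps : K) : set \bar K :=
  [set q | exists dA dB dC dD (dz : K[i]) (dv : 'cV[K[i]]_(n + p)),
    let P' := sysmx A B C D + (eps%:C)%:P *: sysmx dA dB dC dD in
    [/\ [/\ admissible a dA, admissible b dB, admissible c dC &
            admissible d dD],
        unique_zero_in_disc P' z0 r (z0 + dz),
        v + eps%:C *: dv != 0,
        pm_eval P' (z0 + dz) *m (v + eps%:C *: dv) = 0 &
        q = (normc dz / eps)%:E]].

(* kappa_S(z0) = kappa. The eigenvalue of the perturbed matrix arising from z0
   is the one in a fixed disc around z0 isolating it from the rest of the
   spectrum; the value does not depend on the disc. *)
Definition is_kappaS (kappa : K) : Prop :=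
  (exists r, isolating_radius (sysmx A B C D) z0 r) /\
  forall r, isolating_radius (sysmx A B C D) z0 r ->
    ereal_sup (structured_quotients r eps) @[eps --> 0^'+] --> kappa%:E.

Definition weight_mx (z : K[i]) : 'M[K]_(1 + 1) :=
  block_mx (\sum_i a i * normc z ^+ i)%:M (\sum_i b i * normc z ^+ i)%:M
           (\sum_i c i * normc z ^+ i)%:M (\sum_i d i * normc z ^+ i)%:M.

End Quotients.
End ConditionNumber.

(* Main.v *)
Require Import Defs.
From HB Require Import structures.
From mathcomp Require Import all_boot all_order all_algebra.
From mathcomp Require Import generic_quotient perm ring lra.
From mathcomp Require Import all_classical all_reals all_analysis.
Import Order.TTheory GRing.Theory Num.Theory.
Import numFieldNormedType.Exports.

(** Let P be the system matrix, v = (A^-1 B x, x) and w = (y^T C A^-1, y^T), the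
    matrices being evaluated at z0. These are right and left eigenvectors of P at
    z0, and the product rule gives w P'(z0) v = y^T R'(z0) x ([transfer_deriv]).
    Block elimination relates det P to the determinant of the numerator of R, so
    that z0 is a simple root of det P: det P = (X - z0) h with h(z0) nonzero
    ([simple_zero_sysmx]).

    The perturbed eigenvalues are the roots of the expansion ([det_expansion])

      det (P + e E) = (X - z0) h + e T + e^2 H,   T = tr (adj P E),

    in which the norms of T and H are bounded by those of the entries of P and E.
    Hence every root z in the isolating disc satisfies
    |z - z0| |h(z0)| = e |T(z0)| + O(e^2), uniformly in the admissible E
    ([eigenvalue_first_order]). By Jacobi's formula h(z0) = tr (adj P P')(z0), and
    the adjugate has rank one at a simple eigenvalue: adj P(z0) = g v w. Therefore
    T(z0) / h(z0) = w E(z0) v / w P'(z0) v ([simple_eigenvalue_gradient]).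

    It remains to maximize |w E(z0) v| over the admissible E. Splitting it into the
    contributions of the four blocks and of their coefficients, the
    Cauchy-Schwarz inequality and the definition of the spectral norm bound it by
    the numerator of the stated formula ([sensitivity_bound]); rank-one
    coefficients with suitable phases reach the bound ([sensitivity_attained]).
    For this extremal E a perturbed eigenvalue does exist and is unique in the disc
    for small e ([eigenvalue_continuation]), so that it contributes a quotient.
    Thus the supremum differs from the stated value by at most a constant times e,
    which yields the limit.

    A root of the determinant is a zero in the sense of local Smith forms because
    such forms exist for every regular polynomial matrix ([smith_existence],
    [zero_ofP]). *)

Set Implicit Arguments.
Unset Strict Implicit.
Unset Printing Implicit Defensive.

Local Open Scope ring_scope.

Local Notation "x %:F" := (@FracField.tofrac _ x).

(** * Values and derivatives of rational functions *)

Section Fractions.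
Context {F : fieldType}.
Implicit Types (f : ratfun F) (u w : {poly F}) (z : F).

Lemma rf_reduced f :
  [/\ rf_den f != 0, f = (rf_num f)%:F / (rf_den f)%:F
    & coprimep (rf_num f) (rf_den f)].
Proof.
rewrite /rf_num /rf_den; case E: (frac (repr f)) => [u w] /=.
have w0 : w != 0 by have := denom_ratioP (repr f); rewrite E.
have g0 : gcdp u w != 0 by rewrite gcdp_eq0 negb_and w0 orbT.
have wE := divpK (dvdp_gcdr u w); have uE := divpK (dvdp_gcdl u w).
have d0 : w %/ gcdp u w != 0 by apply: contraNneq w0 => e; rewrite -wE e mul0r.
split=> //; last by apply: coprimep_div_gcd; rewrite w0 orbT.
have fE : f = u%:F / w%:F.
  have -> : f = (\pi_({fraction {poly F}}) (repr f))%qT by rewrite reprK.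
  rewrite -(Ratio_numden (repr f)) E /=.
  apply: (canRL (mulfK _)); first by rewrite tofrac_eq0.
  rewrite /FracField.tofrac; unlock.
  rewrite -[LHS]FracField.pi_mul; apply/eqP.
  rewrite FracField.equivf_def /FracField.mulf.
  rewrite !numden_Ratio ?oner_eq0 ?mulr1 //.
  by rewrite mulrC.
rewrite {1}fE; apply/eqP; rewrite eqr_div ?tofrac_eq0 // -!rmorphM tofrac_eq /=.
apply/eqP; move: uE wE; set u' := u %/ _; set w' := w %/ _ => uE wE.
by rewrite -[u in LHS]uE -[w in RHS]wE; ring.
Qed.

(** Any fraction is the reduced one with a common factor g restored. Since g
    does not vanish where w does not, values and derivatives may be computed from
    any fraction. *)
Lemma rf_common_factor u w : w != 0 ->
  exists2 g, g != 0 & u = rf_num (u%:F / w%:F) * g /\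
                      w = rf_den (u%:F / w%:F) * g.
Proof.
move=> w0; set f := _ / _.
have [d0 fE cop] := rf_reduced f.
have e : u * rf_den f = rf_num f * w.
  apply/eqP; rewrite -tofrac_eq !rmorphM /=.
  by rewrite -eqr_div ?tofrac_eq0 // -fE.
have dw : rf_den f %| w.
  have <- : (rf_den f %| rf_num f * w) = (rf_den f %| w).
    by apply: Gauss_dvdpr; rewrite coprimep_sym.
  by rewrite -e dvdp_mulIr.
exists (w %/ rf_den f).
  by apply: contraNneq w0 => e'; rewrite -(divpK dw) e' mul0r.
have wE : w = rf_den f * (w %/ rf_den f) by rewrite mulrC divpK.
split=> //; apply: (mulIf d0).
by rewrite e {1}wE; ring.
Qed.

Lemma rf_eval_frac u w z : w.[z] != 0 ->
  ~~ pole (u%:F / w%:F) z /\ rf_eval (u%:F / w%:F) z = u.[z] / w.[z].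
Proof.
move=> wz; have w0 : w != 0 by apply: contraNneq wz => ->; rewrite horner0.
have [g g0 [uE wE]] := rf_common_factor u w0.
rewrite /pole /rf_eval /root.
move: uE wE wz; set f := _ / _ => uE wE; rewrite wE hornerM mulf_eq0 negb_or.
case/andP=> dz gz; split=> //.
by rewrite uE !hornerM -mulf_div divff ?mulr1.
Qed.

Lemma rf_deriv_frac u w : w != 0 ->
  rf_deriv (u%:F / w%:F) = (u^`() * w - u * w^`())%:F / (w ^+ 2)%:F.
Proof.
move=> w0; have [g g0 [uE wE]] := rf_common_factor u w0.
rewrite /rf_deriv; move: uE wE; set f := _ / _ => uE wE.
have d0 : rf_den f != 0 by apply: contraNneq w0 => e; rewrite wE e mul0r.
apply/eqP; rewrite eqr_div ?tofrac_eq0 ?expf_neq0 // -!rmorphM tofrac_eq /=.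
apply/eqP; rewrite [in RHS]uE wE !derivM; ring.
Qed.

End Fractions.

(** * Evaluation of polynomial matrices *)

Section Evaluation.
Context {F : fieldType}.
Implicit Types z : F.

Lemma pm_evalM m n k (M : 'M[{poly F}]_(m, n)) (N : 'M[{poly F}]_(n, k)) z :
  pm_eval (M *m N) z = pm_eval M z *m pm_eval N z.
Proof. exact: (map_mxM (horner_eval z)). Qed.

Lemma pm_evalD m n (M N : 'M[{poly F}]_(m, n)) z :
  pm_eval (M + N) z = pm_eval M z + pm_eval N z.
Proof. exact: (map_mxD (horner_eval z)). Qed.

Lemma pm_evalZ m n (q : {poly F}) (M : 'M[{poly F}]_(m, n)) z :
  pm_eval (q *: M) z = q.[z] *: pm_eval M z.
Proof. exact: (map_mxZ (horner_eval z)). Qed.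

Lemma det_pm_eval m (M : 'M[{poly F}]_m) z : \det (pm_eval M z) = (\det M).[z].
Proof. exact: (det_map_mx (horner_eval z)). Qed.

Lemma pm_eval_adj m (M : 'M[{poly F}]_m) z :
  pm_eval (\adj M) z = \adj (pm_eval M z).
Proof. by rewrite /pm_eval (map_mx_adj (horner_eval z)). Qed.

Lemma pm_eval_sysmx n p (A : 'M[{poly F}]_n) (B : 'M[{poly F}]_(n, p))
    (C : 'M[{poly F}]_(p, n)) (D : 'M[{poly F}]_p) z :
  pm_eval (sysmx A B C D) z =
    block_mx (- pm_eval A z) (pm_eval B z) (pm_eval C z) (pm_eval D z).
Proof. by rewrite /pm_eval /sysmx map_block_mx (map_mxN (horner_eval z)). Qed.

Lemma pm_ratmxM m n k (M : 'M[{poly F}]_(m, n)) (N : 'M[{poly F}]_(n, k)) :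
  pm_ratmx (M *m N) = pm_ratmx M *m pm_ratmx N.
Proof. exact: map_mxM. Qed.

Lemma clear_denominators m (G : 'M[ratfun F]_m) z :
  (forall i j, ~~ pole (G i j) z) ->
  exists w (U : 'M[{poly F}]_m), [/\ w.[z] != 0, pm_ratmx U = w%:F *: G
    & pm_eval U z = w.[z] *: rm_eval G z].
Proof.
move=> nopole; pose w := \prod_i \prod_j rf_den (G i j).
have wz : w.[z] != 0.
  rewrite horner_prod; apply/prodf_neq0 => i _.
  by rewrite horner_prod; apply/prodf_neq0 => j _; apply: nopole.
have dvd i j : w = w %/ rf_den (G i j) * rf_den (G i j).
  by rewrite divpK // /w (bigD1 i) //= (bigD1 j) //= -mulrA dvdp_mulr.
exists w, (\matrix_(i, j) (w %/ rf_den (G i j) * rf_num (G i j))).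
split=> //; apply/matrixP => i j; rewrite !mxE.
  have [d0 GE _] := rf_reduced (G i j).
  rewrite [in RHS]GE {2}(dvd i j) !rmorphM /= -mulrA; congr (_ * _).
  by rewrite mulrCA divff ?mulr1 // tofrac_eq0.
have -> : w.[z] = (w %/ rf_den (G i j)).[z] * (rf_den (G i j)).[z].
  by rewrite -hornerM -dvd.
rewrite hornerM -mulrA; congr (_ * _).
by rewrite /rf_eval mulrCA divff ?mulr1 //; apply: nopole.
Qed.

End Evaluation.

(** * Local Smith form and zeros *)

Section Smith.
Context {F : fieldType}.
Variable z : F.
Local Notation X_z := ('X - z%:P).

Definition power_diag m (k : 'I_m -> nat) : 'M[{poly F}]_m :=
  diag_mx (\row_i X_z ^+ k i).

Lemma det_power_diag m (k : 'I_m -> nat) :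
  \det (power_diag k) = X_z ^+ (\sum_i k i).
Proof.
by rewrite det_diag expr_sum; apply: eq_bigr => i _; rewrite mxE.
Qed.

(** Clearing denominators turns the local Smith form of a matrix without pole at
    z into an identity between polynomial matrices. No exponent is negative: the
    factor w, which is nonzero at z, would otherwise be divisible by X - z. *)
Lemma local_smith_poly m (q : {poly F}) (N : 'M[{poly F}]_m) nu :
  q.[z] != 0 ->
  local_smith_exponents ((q%:F)^-1 *: pm_ratmx N) z nu ->
  exists U1 U2 w (k : 'I_m -> nat),
    [/\ [/\ w.[z] != 0, \det (pm_eval U1 z) != 0 & \det (pm_eval U2 z) != 0],
        forall i, nu i = k i & U1 *m N *m U2 = w *: power_diag k].
Proof.
move=> qz [_ [G1 [G2 [[np1 d1] [np2 d2] GE]]]].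
have [w1 [U1 [w1z U1E U1z]]] := clear_denominators np1.
have [w2 [U2 [w2z U2E U2z]]] := clear_denominators np2.
have q0 : q != 0 by apply: contraNneq qz => ->; rewrite horner0.
pose w := w1 * w2 * q.
have wz : w.[z] != 0 by rewrite /w !hornerM !mulf_neq0.
have UE : pm_ratmx (U1 *m N *m U2) =
    w%:F *: diag_mx (\row_i (X_z)%:F ^ nu i).
  rewrite -GE !pm_ratmxM U1E U2E /w !rmorphM /=.
  rewrite -!(scalemxAl, scalemxAr) !scalerA; congr (_ *: _).
  by rewrite -mulrA mulfV ?mulr1 ?tofrac_eq0 // mulrC.
clearbody w.
have entry i : ((U1 *m N *m U2) i i)%:F = w%:F * (X_z)%:F ^ nu i :> ratfun F.
  by have /matrixP/(_ i i) := UE; rewrite !mxE eqxx mulr1n.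
have X0 : (X_z)%:F != 0 :> ratfun F by rewrite tofrac_eq0 polyXsubC_eq0.
have nu_ge0 i : exists k : nat, nu i = k.
  case E: (nu i) => [k|k]; first by exists k.
  have : w%:F = ((U1 *m N *m U2) i i * X_z ^+ k.+1)%:F :> ratfun F.
    rewrite tofracM tofracXn [X in _ = X * _](entry i) E NegzE -exprnN -mulrA.
    by rewrite (mulVf (expf_neq0 _ X0)) mulr1.
  move/eqP; rewrite tofrac_eq => /eqP wE.
  by move: wz; rewrite wE hornerM horner_exp !hornerE subrr expr0n mulr0 eqxx.
have [k kE] := choice nu_ge0.
exists U1, U2, w, k; split=> //.
  by rewrite U1z U2z !detZ !mulf_neq0 ?expf_neq0.
apply/matrixP => i j; have /matrixP/(_ i j) := UE.
rewrite !mxE kE -exprnP => /eqP.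
rewrite -rmorphXn -rmorphMn -rmorphM tofrac_eq => /eqP.
by [].
Qed.

End Smith.

Section SmithExistence.
Context {F : fieldType}.
Variable z : F.
Local Notation X_z := ('X - z%:P).

(** M is equivalent over the local ring at z to a diagonal of nondecreasing
    powers; h collects the units by which the reduction has to multiply in order
    to stay polynomial. *)
Definition smith_at m (M : 'M[{poly F}]_m) : Prop :=
  exists U1 U2 h (k : 'I_m -> nat),
    [/\ [/\ h.[z] != 0, \det (pm_eval U1 z) != 0 & \det (pm_eval U2 z) != 0],
        forall i j : 'I_m, (i <= j)%N -> (k i <= k j)%N
      & U1 *m M *m U2 = h *: power_diag z k].

Lemma smith_at_scale m (M : 'M[{poly F}]_m) : smith_at M -> smith_at (X_z *: M).
Proof.
case=> U1 [U2 [h [k [hU k_le E]]]]; exists U1, U2, h, (fun i => (k i).+1).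
split=> //.
rewrite -scalemxAr -scalemxAl E scalerA mulrC -scalerA; congr (_ *: _).
by apply/matrixP=> i j; rewrite !mxE mulrnAr -exprS.
Qed.

Lemma smith_at_mul m (V1 V2 M : 'M[{poly F}]_m) :
  \det (pm_eval V1 z) != 0 -> \det (pm_eval V2 z) != 0 ->
  smith_at (V1 *m M *m V2) -> smith_at M.
Proof.
move=> d1 d2 [U1 [U2 [h [k [[hz u1 u2] k_le E]]]]].
exists (U1 *m V1), (V2 *m U2), h, k; split=> //; last by rewrite -E !mulmxA.
by rewrite !pm_evalM !det_mulmx !mulf_neq0.
Qed.

Lemma smith_at_block m (a : {poly F}) (S : 'M[{poly F}]_m) : a.[z] != 0 ->
  smith_at S -> smith_at (block_mx (a%:M : 'M[{poly F}]_1) 0 0 S).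
Proof.
move=> az [U1 [U2 [h [k [[hz u1 u2] k_le E]]]]].
pose k' (i : 'I_(1 + m)) :=
  match fintype.split i with inl _ => 0%N | inr j => k j end.
exists (block_mx h%:M 0 0 (a *: U1)), (block_mx 1%:M 0 0 U2), (h * a), k'.
split.
- split; first by rewrite hornerM mulf_neq0.
    rewrite det_pm_eval det_ublock det_scalar1 detZ !hornerM horner_exp.
    by rewrite -det_pm_eval !mulf_neq0 ?expf_neq0.
  by rewrite det_pm_eval det_ublock det1 mul1r -det_pm_eval.
- move=> i j; rewrite /k'.
  case: fintype.splitP => i' iE; case: fintype.splitP => j' jE //.
    by rewrite iE jE (ord1 j').
  by rewrite iE jE leq_add2l; apply: k_le.
rewrite !mulmx_block !(mul0mx, mulmx0, addr0, add0r, mulmx1).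
rewrite -scalemxAl -scalemxAl E -scalar_mxM scalerA.
have -> : power_diag z k' = block_mx (1%:M : 'M[{poly F}]_1) 0 0 (power_diag z k).
  rewrite -[1%:M]diag_const_mx -diag_mx_row; congr diag_mx.
  by apply/rowP => i; rewrite !mxE /k'; case: fintype.splitP => j _; rewrite !mxE.
by rewrite scale_block_mx !scaler0 scale_scalar_mx mulr1 [a * h]mulrC.
Qed.

(** One step of elimination: the entry a, invertible at z, clears its row and
    its column after the other rows and columns are multiplied by a. *)
Lemma smith_at_pivot m (M : 'M[{poly F}]_(1 + m)) : \det M != 0 ->
  (M 0 0).[z] != 0 ->
  (forall S : 'M[{poly F}]_m, \det S != 0 -> smith_at S) -> smith_at M.
Proof.
move=> dM az IH; pose a := M 0 0; pose r := ursubmx M; pose c := dlsubmx M.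
have a0 : a != 0 by apply: contraNneq az => e; rewrite -/a e horner0.
have ME : M = block_mx a%:M r c (drsubmx M).
  rewrite -[LHS]submxK; congr block_mx.
  by rewrite [LHS]mx11_scalar !mxE; congr (M _ _)%:M; apply/val_inj.
pose V1 := block_mx (1%:M : 'M[{poly F}]_1) 0 (- c) a%:M.
pose V2 := block_mx (1%:M : 'M[{poly F}]_1) (- r) 0 a%:M.
have d1 : \det V1 = a ^+ m by rewrite det_lblock det1 det_scalar mul1r.
have d2 : \det V2 = a ^+ m by rewrite det_ublock det1 det_scalar mul1r.
pose S := (a *: drsubmx M - c *m r) *m a%:M.
have E : V1 *m M *m V2 = block_mx a%:M 0 0 S.
  rewrite {1}ME !mulmx_block !(mul0mx, mulmx0, addr0, add0r, mulmx1, mul1mx).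
  rewrite !mul_mx_scalar !mul_scalar_mx scalerN !mulNmx.
  rewrite scalerN !addNr mul0mx add0r.
  by rewrite /S mul_mx_scalar addrC.
apply: (@smith_at_mul _ V1 V2);
  rewrite ?det_pm_eval ?d1 ?d2 ?horner_exp ?expf_neq0 //.
rewrite E; apply: smith_at_block => //; apply: IH.
have : \det (V1 *m M *m V2) != 0.
  by rewrite !det_mulmx d1 d2 !mulf_neq0 ?expf_neq0.
by rewrite E det_ublock mulf_eq0 negb_or => /andP[].
Qed.

(** If M vanishes at z, a factor X - z comes out of all entries and the degree of
    the determinant drops; if not, some entry can serve as a pivot and the size
    drops. Since the common factor is taken out before pivoting, the exponents
    come out sorted. *)
Lemma smith_existence m (M : 'M[{poly F}]_m) : \det M != 0 -> smith_at M.
Proof.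
elim: m M => [|m IHm] M.
  move=> _; exists 1%:M, 1%:M, 1, (fun=> 0%N); split=> //.
    by rewrite hornerC oner_eq0 !det_mx00 oner_eq0.
  by rewrite [LHS]flatmx0 [RHS]flatmx0.
have [s] := ubnP (size (\det M)); elim: s M => // s IHs M /ltnSE lt_s dM.
have [M0|] := eqVneq (pm_eval M z) 0.
  have [N ME] : exists N, M = X_z *: N.
    exists (map_mx (fun q => q %/ X_z) M).
    apply/matrixP => i j; rewrite !mxE mulrC divpK // -root_factor_theorem.
    by have /matrixP/(_ i j) := M0; rewrite !mxE => /eqP.
  rewrite {}ME in dM lt_s *; move: dM lt_s.
  rewrite detZ mulf_eq0 negb_or => /andP[X0 dN].
  rewrite size_mul // size_exp_XsubC => lt_s.
  apply: smith_at_scale; apply: IHs dN; apply: leq_trans lt_s.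
  by rewrite ltnS leq_addl.
move=> M0; have [i [j aij]] : exists i j, (M i j).[z] != 0.
  have /rV0Pn[ij] : mxvec (pm_eval M z) != 0.
    by apply: contraNneq M0 => e; rewrite -[pm_eval _ _]mxvecK e linear0.
  by case/mxvec_indexP: ij => i j; rewrite mxvecE mxE => Mij; exists i, j.
pose N : 'M[{poly F}]_(1 + m) := xrow 0 i (xcol 0 j M).
have NE : N = tperm_mx 0 i *m M *m tperm_mx 0 j.
  by rewrite /N xcolE xrowE mulmxA.
have dt k : \det (pm_eval (tperm_mx 0 k : 'M[{poly F}]_m.+1) z) != 0.
  by rewrite det_pm_eval det_perm horner_exp hornerN hornerC signr_eq0.
apply: (smith_at_mul (dt i) (dt j)); rewrite -NE.
apply: smith_at_pivot => //.
  rewrite NE !det_mulmx !det_perm !mulf_neq0 ?signr_eq0 //.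
by rewrite !mxE !tpermL.
Qed.

End SmithExistence.

Section Zeros.
Context {F : fieldType}.
Implicit Types (z : F).

Lemma rm_eval_scale m (h : {poly F}) (U : 'M[{poly F}]_m) z : h.[z] != 0 ->
  (forall i j, ~~ pole (((h%:F)^-1 *: pm_ratmx U) i j) z) /\
  rm_eval ((h%:F)^-1 *: pm_ratmx U) z = h.[z]^-1 *: pm_eval U z.
Proof.
move=> hz; split=> [i j|]; last apply/matrixP => i j; rewrite !mxE mulrC.
  by have [] := rf_eval_frac (U i j) hz.
by have [_ ->] := rf_eval_frac (U i j) hz; rewrite mulrC.
Qed.

(** Zeros are defined by exponents, so that being a root of the determinant makes
    z a zero only once a local Smith form is known to exist; a singular matrix has
    none, hence no zeros. *)
Lemma zero_ofP m (Q : 'M[{poly F}]_m) z :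
  zero_of (pm_ratmx Q) z <-> \det Q != 0 /\ root (\det Q) z.
Proof.
have one_z : (1 : {poly F}).[z] != 0 by rewrite hornerC oner_eq0.
split=> [[nu sm [i nui]]|[dQ rQ]].
  have [|U1 [U2 [w [k [[wz u1 u2] nuE E]]]]] :=
      @local_smith_poly F z m 1 Q nu one_z.
    by rewrite tofrac1 invr1 scale1r.
  have dE : \det U1 * \det Q * \det U2 = w ^+ m * ('X - z%:P) ^+ (\sum_i k i).
    by rewrite -!det_mulmx E detZ det_power_diag.
  have w0 : w != 0 by apply: contraNneq wz => ->; rewrite horner0.
  split.
    have : w ^+ m * ('X - z%:P) ^+ (\sum_i k i) != 0.
      by rewrite mulf_neq0 ?expf_neq0 ?polyXsubC_eq0.
    by rewrite -dE !mulf_eq0 !negb_or => /andP[/andP[]].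
  move: nui; rewrite nuE ltz_nat => ki.
  have /eqP := congr1 (horner^~ z) dE.
  rewrite !hornerM -!det_pm_eval !horner_exp hornerXsubC subrr expr0n.
  rewrite (bigD1 i) //= addn_eq0 (gtn_eqF ki) mulr0 !mulf_eq0.
  by rewrite (negPf u1) (negPf u2) /= orbF det_pm_eval.
have [U1 [U2 [h [k [[hz u1 u2] k_le E]]]]] := smith_existence z dQ.
have h0 : h != 0 by apply: contraNneq hz => ->; rewrite horner0.
exists (fun i => k i); last first.
  apply/not_existsP => k0.
  have {}k0 i : k i = 0%N.
    by have /negP := k0 i; rewrite -leNgt lez_nat leqn0 => /eqP.
  have := det_mulmx (U1 *m Q) U2; rewrite E det_mulmx detZ det_power_diag.
  rewrite big1 // mulr1 => /(congr1 (horner^~ z)) /eqP.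
  rewrite !hornerM (rootP rQ) mulr0 mul0r horner_exp expf_eq0.
  by rewrite (negPf hz) andbF.
split=> [i j ij|]; first by rewrite lez_nat k_le.
have [np1 e1] := rm_eval_scale U1 one_z; have [np2 e2] := rm_eval_scale U2 hz.
exists ((1%:F)^-1 *: pm_ratmx U1), ((h%:F)^-1 *: pm_ratmx U2); split.
- by split=> //; rewrite e1 hornerC (invr1 F) (scale1r (pm_eval U1 z)).
- by split=> //; rewrite e2 detZ mulf_neq0 // expf_neq0 // invr_eq0.
rewrite tofrac1 invr1 scale1r -scalemxAr -!pm_ratmxM E.
apply/matrixP => i j; rewrite !mxE rmorphM mulKf ?tofrac_eq0 //.
by rewrite rmorphMn rmorphXn.
Qed.

(** As the exponents are nonnegative, a simple zero leaves exactly one factor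
    X - z in the determinant. *)
Lemma simple_zero_root m (q : {poly F}) (N : 'M[{poly F}]_m) z : q.[z] != 0 ->
  simple_zero_of ((q%:F)^-1 *: pm_ratmx N) z ->
  exists2 h, h.[z] != 0 & \det N = ('X - z%:P) * h.
Proof.
move=> qz [nu sm [i nui nu_le]].
have [U1 [U2 [w [k [[wz u1 u2] nuE E]]]]] := local_smith_poly qz sm.
have dE : \det U1 * \det N * \det U2 = w ^+ m * ('X - z%:P).
  rewrite -!det_mulmx E detZ det_power_diag (bigD1 i) //= big1 => [|j ji].
    by move: nui; rewrite nuE addn0 => -[->].
  apply/eqP; rewrite -leqn0 leqNgt; apply: contra ji => kj.
  by apply/eqP/nu_le; rewrite nuE.
have rN : root (\det N) z.
  have /eqP := congr1 (horner^~ z) dE.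
  rewrite !hornerM hornerXsubC subrr mulr0 -!det_pm_eval !mulf_eq0.
  by rewrite (negPf u1) (negPf u2) orbF /= det_pm_eval.
have [h hE] := factor_theorem _ _ rN; exists h; last by rewrite hE mulrC.
have X0 : 'X - z%:P != 0 by rewrite polyXsubC_eq0.
have : \det U1 * h * \det U2 = w ^+ m.
  by apply: (mulIf X0); rewrite -dE hE; ring.
move/(congr1 (horner^~ z)); rewrite !hornerM horner_exp => e.
have : w.[z] ^+ m != 0 by rewrite expf_neq0.
by rewrite -e !mulf_eq0 !negb_or => /andP[/andP[]].
Qed.

(** * Transfer function and system matrix *)

Section Transfer.
Variables (n p : nat).
Variables (A : 'M[{poly F}]_n) (B : 'M[{poly F}]_(n, p)).
Variables (C : 'M[{poly F}]_(p, n)) (D : 'M[{poly F}]_p).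

Definition transfer_num : 'M[{poly F}]_p :=
  \det A *: D + C *m \adj A *m B.

Lemma transfer_frac : \det A != 0 ->
  transfer A B C D = (\det A)%:F^-1 *: pm_ratmx transfer_num.
Proof.
move=> A0; have A0' : (\det A)%:F != 0 :> ratfun F by rewrite tofrac_eq0.
have uA : pm_ratmx A \in unitmx.
  by rewrite unitmxE /pm_ratmx det_map_mx unitfE.
rewrite /transfer /invmx uA /pm_ratmx det_map_mx /transfer_num.
rewrite map_mxD map_mxZ scalerDr.
rewrite scalerA (mulVf A0') scale1r; congr (_ + _).
by rewrite !map_mxM map_mx_adj scalemxAl scalemxAr.
Qed.

(** Block elimination on the system matrix, multiplied by the determinant of A
    to stay within polynomials. *)
Lemma det_sysmx :
  \det A ^+ p * \det (sysmx A B C D) =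
    (-1) ^+ n * \det A * \det transfer_num.
Proof.
have := det_mulmx (block_mx 1%:M 0 (C *m \adj A) (\det A)%:M) (sysmx A B C D).
rewrite det_lblock det1 mul1r det_scalar => <-.
rewrite mulmx_block !(mul1mx, mul0mx, addr0) !mul_scalar_mx.
rewrite mulmxN -mulmxA mul_adj_mx mul_mx_scalar addNr det_ublock.
by rewrite -scaleN1r detZ addrC.
Qed.

Lemma simple_zero_sysmx z : (\det A).[z] != 0 ->
  simple_zero_of (transfer A B C D) z ->
  exists2 h, h.[z] != 0 & \det (sysmx A B C D) = ('X - z%:P) * h.
Proof.
move=> Az; have A0 : \det A != 0 by apply: contraNneq Az => ->; rewrite horner0.
rewrite transfer_frac // => /(simple_zero_root Az)[g gz gE].
have e := det_sysmx; rewrite gE in e.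
have rP : root (\det (sysmx A B C D)) z.
  have /eqP := congr1 (horner^~ z) e.
  rewrite !hornerM hornerXsubC subrr mul0r mulr0 horner_exp mulf_eq0.
  by rewrite expf_eq0 (negPf Az) andbF.
have [h hE] := factor_theorem _ _ rP; exists h; last by rewrite hE mulrC.
have X0 : 'X - z%:P != 0 by rewrite polyXsubC_eq0.
have : \det A ^+ p * h = (-1) ^+ n * \det A * g.
  by apply: (mulfI X0); rewrite mulrCA [_ * h]mulrC -hE e; ring.
move/(congr1 (horner^~ z)); rewrite !hornerM horner_exp => e'.
apply: contraTneq isT => h0; move/eqP: e'; rewrite h0 mulr0 eq_sym.
rewrite !mulf_eq0 (negPf Az) (negPf gz) !orbF.
by rewrite horner_exp hornerN hornerC signr_eq0.
Qed.

End Transfer.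
End Zeros.

(** * The adjugate at a simple eigenvalue *)

Section Derivatives.
Context {F : comNzRingType}.

Definition pm_deriv m n (M : 'M[{poly F}]_(m, n)) : 'M[{poly F}]_(m, n) :=
  map_mx (fun q : {poly F} => q^`()) M.

Lemma pm_derivM m n k (M : 'M[{poly F}]_(m, n)) (N : 'M[{poly F}]_(n, k)) :
  pm_deriv (M *m N) = pm_deriv M *m N + M *m pm_deriv N.
Proof.
apply/matrixP => i j; rewrite !mxE linear_sum -big_split /=.
by apply: eq_bigr => l _; rewrite derivM !mxE.
Qed.

Lemma pm_derivD m n (M N : 'M[{poly F}]_(m, n)) :
  pm_deriv (M + N) = pm_deriv M + pm_deriv N.
Proof. by apply/matrixP => i j; rewrite !mxE derivD. Qed.

Lemma pm_derivZ m n (q : {poly F}) (M : 'M[{poly F}]_(m, n)) :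
  pm_deriv (q *: M) = q^`() *: M + q *: pm_deriv M.
Proof. by apply/matrixP => i j; rewrite !mxE derivM. Qed.

Lemma deriv_prod (I : finType) (f : I -> {poly F}) :
  (\prod_i f i)^`() = \sum_k (f k)^`() * \prod_(i | k != i) f i.
Proof.
suff H (r : seq I) : uniq r -> (\prod_(i <- r) f i)^`() =
    \sum_(k <- r) (f k)^`() * \prod_(i <- r | k != i) f i.
  by apply: H; apply: index_enum_uniq.
elim: r => [_|j r IH /= /andP[jr ur]]; first by rewrite !big_nil derivC.
rewrite !big_cons derivM IH // eqxx; congr (_ * _ + _).
  rewrite [RHS]big_seq_cond [LHS]big_seq_cond; apply: eq_bigl => i.
  by case: (boolP (i \in r)) => //= ir; case: eqP jr => // ->; rewrite ir.
rewrite big_distrr /= [LHS]big_seq [RHS]big_seq; apply: eq_bigr => k kr.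
have kj : k != j by apply: contraNneq jr => <-.
by rewrite big_cons kj mulrCA.
Qed.

(** Jacobi's formula. *)
Lemma deriv_det m (M : 'M[{poly F}]_m) :
  (\det M)^`() = \tr (\adj M *m pm_deriv M).
Proof.
rewrite mxtrace_mulC /mxtrace /determinant linear_sum /=.
transitivity (\sum_(s : {perm 'I_m}) \sum_k
    (M k (s k))^`() * ((-1) ^+ s * \prod_(i | k != i) M i (s i))).
  apply: eq_bigr => s _; rewrite mulr_sign; case: (odd_perm s).
    rewrite derivN deriv_prod -sumrN; apply: eq_bigr => k _.
    by rewrite mulr_sign mulrN.
  by rewrite deriv_prod; apply: eq_bigr => k _; rewrite mulr_sign.
rewrite exchange_big; apply: eq_bigr => k _; rewrite mxE.
rewrite (partition_big (fun s : {perm 'I_m} => s k) xpredT) //=.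
apply: eq_bigr => j _; rewrite !mxE expand_cofactor big_distrr /=.
by apply: eq_big => s // /eqP ->.
Qed.

End Derivatives.

Lemma pm_deriv_sysmx {F : fieldType} n p
    (A : 'M[{poly F}]_n) (B : 'M[{poly F}]_(n, p))
    (C : 'M[{poly F}]_(p, n)) (D : 'M[{poly F}]_p) :
  pm_deriv (sysmx A B C D) =
    sysmx (pm_deriv A) (pm_deriv B) (pm_deriv C) (pm_deriv D).
Proof.
rewrite /pm_deriv /sysmx map_block_mx; congr block_mx.
by apply/matrixP => i j; rewrite !mxE derivN.
Qed.

Lemma rm_deriv_scale {F : fieldType} m (q : {poly F}) (N : 'M[{poly F}]_m) z :
  q.[z] != 0 ->
  rm_eval (rm_deriv (q%:F^-1 *: pm_ratmx N)) z =
    q.[z]^-1 *: pm_eval (pm_deriv N) z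
    - (q.[z] ^- 2 * q^`().[z]) *: pm_eval N z.
Proof.
move=> qz; have q0 : q != 0 by apply: contraNneq qz => ->; rewrite horner0.
apply/matrixP => i j; rewrite !mxE [_^-1 * _]mulrC (rf_deriv_frac _ q0).
have q2z : (q ^+ 2).[z] != 0 by rewrite horner_exp expf_neq0.
rewrite (proj2 (rf_eval_frac _ q2z)) horner_exp hornerD hornerN !hornerM.
by field.
Qed.

Section RankOne.
Context {F : fieldType}.

(** A nonzero cofactor is an invertible submatrix of size m - 1. *)
Lemma adj_neq0_rank m (M : 'M[F]_m) : \adj M != 0 -> (m.-1 <= \rank M)%N.
Proof.
case: m M => // m M adj0.
have [i [j]] : exists i j, cofactor M i j != 0.
  apply/not_existsP => N; case/negP: adj0; apply/eqP/matrixP => i j.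
  rewrite !mxE; apply/eqP; apply: contra_notT (N j) => ?; by exists i.
rewrite /cofactor mulf_eq0 signr_eq0 /= => d.
have : \rank (row' i (col' j M)) = m.
  by rewrite mxrank_unit // unitmxE unitfE.
move=> {1}<- /=; apply: leq_trans (mxrankS (rowsub_sub (lift i) _)) _.
by rewrite -(mxrank_tr (col' j M)) tr_col' -(mxrank_tr M) mxrankS // rowsub_sub.
Qed.

Lemma kernel_line m k (M : 'M[F]_m) (w : 'rV[F]_m) (N : 'M[F]_(k, m)) :
  (m.-1 <= \rank M)%N -> w != 0 -> w *m M = 0 -> N *m M = 0 ->
  exists c : 'cV[F]_k, N = c *m w.
Proof.
move=> rM w0 wM NM; apply/submxP.
have sw : (w <= kermx M)%MS by apply/sub_kermxP.
apply: submx_trans (_ : (kermx M <= w)%MS); first exact/sub_kermxP.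
rewrite -(geq_leqif (mxrank_leqif_sup sw)) mxrank_ker rank_rV w0 /=.
by case: m M w N rM w0 wM NM sw => //= m *; rewrite leq_subLR addn1.
Qed.

(** The products of M with its adjugate are 0, so the rows of the adjugate are
    left null vectors and its columns right null vectors, and both kernels are
    lines. *)
Lemma adj_rank_one m (M : 'M[F]_m) (v : 'cV[F]_m) (w : 'rV[F]_m) :
  v != 0 -> w != 0 -> M *m v = 0 -> w *m M = 0 -> \adj M != 0 ->
  exists c : F, \adj M = c *: (v *m w).
Proof.
move=> v0 w0 Mv wM adj0; have rM := adj_neq0_rank adj0.
have dM : \det M = 0.
  have := congr1 (fun N => N *m v) (mul_adj_mx M).
  rewrite -mulmxA Mv mulmx0 mul_scalar_mx.
  by move/esym/eqP; rewrite scaler_eq0 (negPf v0) orbF => /eqP.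
have [|u uE] := kernel_line rM w0 wM (N := \adj M).
  by rewrite mul_adj_mx dM raddf0.
have Mu : M *m u = 0.
  apply/eqP; have := mul_mx_adj M; rewrite dM raddf0 uE mulmxA => /eqP.
  have [i wi] := rV0Pn _ w0.
  move/eqP/matrixP => E; apply/eqP/colP => j; have /eqP := E j i.
  by rewrite [in X in X -> _]mxE big_ord1 !mxE mulf_eq0 (negPf wi) orbF => /eqP.
have [| | | |c cE] := @kernel_line m 1 M^T v^T u^T; rewrite ?mxrank_tr //.
- by rewrite trmx_eq0.
- by rewrite -trmx_mul Mv trmx0.
- by rewrite -trmx_mul Mu trmx0.
exists (c 0 0); rewrite uE -[u]trmxK cE trmx_mul trmxK.
rewrite [c]mx11_scalar tr_scalar_mx.
by rewrite mul_mx_scalar scalemxAl mxE eqxx mulr1n.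
Qed.

End RankOne.

(** * Eigenvectors of the transfer function and of the system matrix *)

Section TransferDerivative.
Context {F : fieldType}.
Variables (n p : nat).
Variables (A : 'M[{poly F}]_n) (B : 'M[{poly F}]_(n, p)).
Variables (C : 'M[{poly F}]_(p, n)) (D : 'M[{poly F}]_p) (z : F).
Hypothesis Az : \det (pm_eval A z) != 0.
Local Notation R := (transfer A B C D).
Local Notation P := (sysmx A B C D).
Local Notation invA0 := (invmx (pm_eval A z)).
Local Notation ev := (fun M => pm_eval M z).

Definition sys_right (x : 'cV[F]_p) : 'cV[F]_(n + p) :=
  col_mx (invA0 *m pm_eval B z *m x) x.

Definition sys_left (y : 'cV[F]_p) : 'rV[F]_(n + p) :=
  row_mx (y^T *m pm_eval C z *m invA0) y^T.

Let uA : pm_eval A z \in unitmx.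
Proof. by rewrite unitmxE unitfE. Qed.

Let qz : (\det A).[z] != 0. Proof. by rewrite -det_pm_eval. Qed.

Let A0 : \det A != 0.
Proof. by apply: contraNneq qz => ->; rewrite horner0. Qed.

Let adjE : pm_eval (\adj A) z = (\det A).[z] *: invA0.
Proof.
by rewrite pm_eval_adj /invmx uA -det_pm_eval scalerA divff // scale1r.
Qed.

Lemma transfer_num_eval : pm_eval (transfer_num A B C D) z =
  (\det A).[z] *: (pm_eval D z + pm_eval C z *m invA0 *m pm_eval B z).
Proof.
rewrite /transfer_num pm_evalD pm_evalZ !pm_evalM adjE -scalemxAr -scalemxAl.
by rewrite scalerDr.
Qed.

Lemma transfer_eval :
  rm_eval R z = pm_eval D z + pm_eval C z *m invA0 *m pm_eval B z.
Proof.
rewrite transfer_frac //.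
have [_ ->] := rm_eval_scale (transfer_num A B C D) qz.
by rewrite transfer_num_eval scalerA mulVf ?scale1r.
Qed.

Lemma sys_right_ker x : rm_eval R z *m x = 0 -> pm_eval P z *m sys_right x = 0.
Proof.
move=> Rx; rewrite pm_eval_sysmx mul_block_col mulNmx -mulmxA mulKVmx // addNr.
by rewrite -col_mx0 !mulmxA -mulmxDl addrC -transfer_eval Rx.
Qed.

Lemma sys_left_ker y : y^T *m rm_eval R z = 0 -> sys_left y *m pm_eval P z = 0.
Proof.
move=> yR; rewrite pm_eval_sysmx mul_row_block mulmxN mulmxKV // addNr.
by rewrite -row_mx0 -!mulmxA -mulmxDr addrC !mulmxA -transfer_eval yR.
Qed.

Lemma deriv_adj_eval : pm_eval (pm_deriv (\adj A)) z =
  (\det A)^`().[z] *: invA0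
  - (\det A).[z] *: (invA0 *m pm_eval (pm_deriv A) z *m invA0).
Proof.
have e : pm_deriv A *m \adj A + A *m pm_deriv (\adj A) = ((\det A)^`())%:M.
  rewrite -pm_derivM mul_mx_adj; apply/matrixP => i j.
  by rewrite !mxE derivMn.
have := congr1 ev e; rewrite /= pm_evalD !pm_evalM adjE.
have -> : pm_eval ((\det A)^`())%:M z = ((\det A)^`().[z])%:M :> 'M[F]_n.
  by apply/matrixP => i j; rewrite !mxE hornerMn.
rewrite addrC => /(canRL (addrK _)) /(congr1 (mulmx invA0)).
rewrite mulKmx // => ->.
by rewrite mulmxBr mul_mx_scalar -!scalemxAr mulmxA.
Qed.

(** The terms of the product rule that contain the value of the transfer function
    vanish, because this value annihilates x; the remaining ones are those of the
    system matrix. *)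
Lemma transfer_deriv (x y : 'cV[F]_p) : rm_eval R z *m x = 0 ->
  y^T *m rm_eval (rm_deriv R) z *m x =
    sys_left y *m pm_eval (pm_deriv P) z *m sys_right x.
Proof.
move=> Rx; pose N := transfer_num A B C D; pose q := (\det A).[z].
have RE : rm_eval (rm_deriv R) z =
    q^-1 *: pm_eval (pm_deriv N) z
    - (q ^- 2 * (\det A)^`().[z]) *: pm_eval N z.
  by rewrite transfer_frac // rm_deriv_scale.
have N0x : pm_eval N z *m x = 0.
  by rewrite transfer_num_eval -transfer_eval -scalemxAl Rx scaler0.
rewrite RE mulmxBr mulmxBl -[y^T *m _ *m x in X in _ - X]mulmxA.
rewrite -[in X in _ - X]scalemxAl N0x scaler0 mulmx0 subr0.
have -> : q^-1 *: pm_eval (pm_deriv N) z =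
    (q^-1 * (\det A)^`().[z]) *: rm_eval R z +
    (pm_eval (pm_deriv D) z + pm_eval (pm_deriv C) z *m invA0 *m pm_eval B z
     - pm_eval C z *m invA0 *m pm_eval (pm_deriv A) z *m invA0 *m pm_eval B z
     + pm_eval C z *m invA0 *m pm_eval (pm_deriv B) z).
  rewrite /N /transfer_num pm_derivD pm_derivZ !pm_derivM.
  rewrite !(pm_evalD, pm_evalM, pm_evalZ) deriv_adj_eval adjE -/q transfer_eval.
  rewrite mulmxBr mulmxDl -!(scalemxAl, scalemxAr) mulmxDl mulNmx.
  rewrite -!(scalemxAl, scalemxAr) !mulmxA !scalerDr !scalerN !scalerA mulVf //.
  rewrite !scale1r.
  by rewrite -!addrA; congr (_ + _); rewrite [RHS]addrCA; congr (_ + _);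
     rewrite addrCA.
rewrite mulmxDr mulmxDl -[y^T *m (_ *: _) *m x]mulmxA -scalemxAl Rx scaler0.
rewrite mulmx0 add0r.
rewrite pm_deriv_sysmx pm_eval_sysmx /sys_left /sys_right.
rewrite mul_row_block mul_row_col.
rewrite !(mulmxDr, mulmxDl, mulmxBr, mulmxN, mulNmx, mulmxA).
by rewrite [LHS](ACl ((3*2)*(4*1))).
Qed.

End TransferDerivative.

(** * Polynomial norms and expansion of determinants *)

Section Seminorms.
Context {K : realFieldType}.

Record submultiplicative (R : comNzRingType) (N : R -> K) : Prop := {
  sn_ge0 : forall x, 0 <= N x;
  sn0 : N 0 = 0;
  sn1 : N 1 <= 1;
  snN : forall x, N (- x) = N x;
  snD : forall x y, N (x + y) <= N x + N y;
  snM : forall x y, N (x * y) <= N x * N y }.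

(** The l1 norm of the coefficients with weights r ^ i. Taking the coefficient
    norm N as a parameter allows iterating it, for polynomials in the perturbation
    parameter with coefficients that are polynomials in lambda. *)
Definition wnorm (R : comNzRingType) (N : R -> K) (r : K) (p : {poly R}) : K :=
  (map_poly N p).[r].

Lemma ler_horner (a b : {poly K}) (r : K) : 0 <= r ->
  (forall i, a`_i <= b`_i) -> a.[r] <= b.[r].
Proof.
move=> r0 ab; pose n := maxn (size a) (size b).
rewrite (horner_coef_wide r (leq_maxl (size a) (size b))).
rewrite (horner_coef_wide r (leq_maxr (size a) (size b))).
by apply: ler_sum => i _; rewrite ler_wpM2r // exprn_ge0.
Qed.

Section Fixed.
Variables (R : comNzRingType) (N : R -> K).
Hypothesis HN : submultiplicative N.

Lemma sn_sum (I : Type) (s : seq I) (P : pred I) (f : I -> R) :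
  N (\sum_(i <- s | P i) f i) <= \sum_(i <- s | P i) N (f i).
Proof.
elim/big_rec2: _ => [|i y x _ le_xy]; first by rewrite (sn0 HN).
by apply: le_trans (snD HN _ _) _; rewrite lerD2l.
Qed.

Lemma sn_prod (I : Type) (s : seq I) (P : pred I) (f : I -> R) :
  N (\prod_(i <- s | P i) f i) <= \prod_(i <- s | P i) N (f i).
Proof.
elim/big_rec2: _ => [|i y x _ le_xy]; first exact: (sn1 HN).
by apply: le_trans (snM HN _ _) _; rewrite ler_wpM2l // (sn_ge0 HN).
Qed.

Lemma coef_wnorm (p : {poly R}) i : (map_poly N p)`_i = N p`_i.
Proof. by rewrite coef_map_id0 ?(sn0 HN). Qed.

Lemma submultiplicative_wnorm r : 0 <= r -> submultiplicative (wnorm N r).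
Proof.
move=> r0; split.
- move=> p; rewrite -(horner0 r); apply: ler_horner => // i.
  by rewrite coef0 coef_wnorm (sn_ge0 HN).
- by rewrite /wnorm map_poly0 ?horner0 // (sn0 HN).
- rewrite -[1 in leRHS](hornerC 1 r); apply: ler_horner => // i.
  rewrite coef_wnorm !coef1; case: eqP => _; first exact: sn1.
  by rewrite (sn0 HN).
- move=> p; congr _.[r]; apply/polyP => i.
  by rewrite !coef_wnorm coefN (snN HN).
- move=> p q; rewrite -hornerD; apply: ler_horner => // i.
  by rewrite coefD !coef_wnorm coefD (snD HN).
move=> p q; rewrite -hornerM; apply: ler_horner => // i.
rewrite coef_wnorm !coefM; apply: le_trans (sn_sum _ _ _) _.
by apply: ler_sum => j _; rewrite !coef_wnorm (snM HN).
Qed.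

Lemma wnormC r (c : R) : wnorm N r c%:P = N c.
Proof.
rewrite /wnorm [map_poly _ _](_ : _ = (N c)%:P) ?hornerC //.
apply/polyP => i; rewrite coef_wnorm !coefC; case: eqP => // _; exact: sn0.
Qed.

Lemma wnormMX r (p : {poly R}) : wnorm N r (p * 'X) = wnorm N r p * r.
Proof.
rewrite /wnorm -hornerMX; congr _.[r]; apply/polyP => i.
rewrite coefMX coef_wnorm coefMX.
by case: eqP => _; rewrite ?coef_wnorm ?(sn0 HN).
Qed.

Lemma sn_horner (p : {poly R}) x r : N x <= r -> N p.[x] <= wnorm N r p.
Proof.
move=> xr; have x0 := sn_ge0 HN x; have r0 := le_trans x0 xr.
elim/poly_ind: p => [|p c IH].
  by rewrite horner0 (sn0 HN) (sn_ge0 (submultiplicative_wnorm r0)).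
rewrite hornerD hornerMX hornerC; apply: le_trans (snD HN _ _) _.
have -> : wnorm N r (p * 'X + c%:P) = wnorm N r p * r + N c.
  rewrite -wnormMX -(wnormC r c) /wnorm -hornerD; congr _.[r]; apply/polyP => i.
  rewrite coefD !coef_wnorm coefD !coefMX coefC; case: eqP => _.
    by rewrite (sn0 HN) !add0r.
  by rewrite (sn0 HN) !addr0.
rewrite lerD2r; apply: le_trans (snM HN _ _) _.
by apply: ler_pM => //; apply: sn_ge0.
Qed.

Lemma wnorm_drop n (p : {poly R}) : wnorm N 1 (drop_poly n p) <= wnorm N 1 p.
Proof.
have -> : wnorm N 1 (drop_poly n p) = (map_poly N (drop_poly n p) * 'X^n).[1].
  by rewrite hornerM hornerXn expr1n mulr1.
apply: ler_horner => // i.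
rewrite coefMXn !coef_wnorm coef_drop_poly; case: ltnP => [_|le_ni].
  exact: sn_ge0.
by rewrite subnK.
Qed.

Lemma coef_le_wnorm (p : {poly R}) i : N p`_i <= wnorm N 1 p.
Proof.
have -> : N p`_i = ((N p`_i) *: 'X^i).[1].
  by rewrite hornerZ hornerXn expr1n mulr1.
apply: ler_horner => // j; rewrite coefZ coefXn coef_wnorm.
by case: eqP => [->|_]; rewrite ?mulr1 // mulr0 (sn_ge0 HN).
Qed.

Lemma sn_det m (M : 'M[R]_m) b : (forall i j, N (M i j) <= b) ->
  N (\det M) <= m`!%:R * b ^+ m.
Proof.
move=> Mb; apply: le_trans (sn_sum _ _ _) _.
have -> : m`!%:R * b ^+ m = \sum_(s : {perm 'I_m}) b ^+ m.
  by rewrite sumr_const card_Sn mulr_natl.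
apply: ler_sum => s _; rewrite mulr_sign.
have -> : N (if s then - \prod_i M i (s i) else \prod_i M i (s i)) =
    N (\prod_i M i (s i)) by case: ifP => // _; rewrite (snN HN).
apply: le_trans (sn_prod _ _ _) _.
rewrite -[m in b ^+ m]card_ord -prodr_const.
by apply: ler_prod => i _; rewrite (sn_ge0 HN) Mb.
Qed.

End Fixed.

(** The remainder H is obtained from the determinant of M + Y E, a polynomial in
    Y, by dropping its two lowest terms. Its norm is controlled by the norms of the
    entries alone, which makes the later estimates uniform in E. *)
Lemma det_expansion (R : comNzRingType) (N : R -> K) m (M E : 'M[R]_m) b e :
  submultiplicative N -> (forall i j, N (M i j) <= b) ->
  (forall i j, N (E i j) <= b) -> N e <= 1 ->
  exists H, [/\ N H <= m`!%:R * (b + b) ^+ m,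
    N (\tr (\adj M *m E)) <= m`!%:R * (b + b) ^+ m &
    \det (M + e *: E) = \det M + e * \tr (\adj M *m E) + e ^+ 2 * H].
Proof.
move=> HN Mb Eb e1; have HN1 := submultiplicative_wnorm HN ler01.
pose Q : 'M[{poly R}]_m := map_mx polyC M + 'X *: map_mx polyC E.
pose G := \det Q; exists (drop_poly 2 G).[e].
have GQ : wnorm N 1 G <= m`!%:R * (b + b) ^+ m.
  apply: (sn_det HN1) => i j; rewrite !mxE mulrC.
  apply: le_trans (snD HN1 _ _) _.
  by rewrite (wnormMX HN) !(wnormC HN) mulr1 lerD.
have Qe x : map_mx (horner_eval x) Q = M + x *: E.
  apply/matrixP => i j; rewrite !mxE /= /horner_eval.
  by rewrite hornerD hornerM hornerX !hornerC.
have Ge x : G.[x] = \det (M + x *: E).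
  by rewrite -Qe (det_map_mx (horner_eval x)).
have G1 : G`_1 = \tr (\adj M *m E).
  have -> : G`_1 = G^`().[0] by rewrite horner_coef0 coef_deriv.
  rewrite /G deriv_det.
  have -> : (\tr (\adj Q *m pm_deriv Q)).[0] =
      \tr (map_mx (horner_eval 0) (\adj Q *m pm_deriv Q)).
    by rewrite (trace_map_mx (horner_eval 0)).
  rewrite map_mxM map_mx_adj Qe scale0r addr0; congr (\tr (_ *m _)).
  apply/matrixP => i j; rewrite !mxE /horner_eval derivD derivM derivX !derivC.
  rewrite mulr0 addr0 mul1r add0r. exact: hornerC.
split.
- apply: le_trans (sn_horner HN _ e1) _.
  exact: le_trans (wnorm_drop HN _ _) GQ.
- by rewrite -G1 (le_trans (coef_le_wnorm HN _ _)).
rewrite -Ge -{1}(poly_take_drop 2 G) hornerD hornerM hornerXn [_ * e ^+ 2]mulrC.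
congr (_ + _); rewrite (horner_coef_wide e (size_take_poly 2 G)).
rewrite !big_ord_recl big_ord0 /= !coef_take_poly /= expr0 mulr1 expr1 addr0 G1.
by rewrite -horner_coef0 Ge scale0r addr0 mulrC.
Qed.

End Seminorms.

(** * Perturbation of a simple root of a polynomial *)

Section Perturbation.
Context {K : realType}.
Local Notation nc := (@Normc.normc K).
Local Open Scope complex_scope.

Lemma normc_submultiplicative : submultiplicative nc.
Proof.
split.
- by case=> a b; apply: sqrtr_ge0.
- exact: Normc.normc0.
- by rewrite Normc.normc1.
- exact: normcN.
- exact: le_normcD.
- by move=> x y; rewrite Normc.normcM.
Qed.

Local Notation ncH := normc_submultiplicative.

Lemma normc_ge0 (z : K[i]) : 0 <= nc z. Proof. exact: (sn_ge0 ncH). Qed.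

Lemma normc_gt0 (z : K[i]) : (0 < nc z) = (z != 0).
Proof.
rewrite lt_def normc_ge0 andbT; congr negb.
by apply/eqP/eqP => [/Normc.eq0_normc //|->]; rewrite Normc.normc0.
Qed.

Lemma normc_real (a : K) : nc a%:C = `|a|.
Proof. by rewrite /Normc.normc /= expr0n addr0 sqrtr_sqr. Qed.

Lemma distcC (x y : K[i]) : nc (x - y) = nc (y - x).
Proof. by rewrite -(normcN (x - y)) opprB. Qed.

Lemma ler_normc_sub (x y : K[i]) : nc x - nc y <= nc (x + y).
Proof.
have := le_normcD (x + y) (- y); rewrite addrK normcN => ?.
by rewrite lerBlDr.
Qed.

Lemma ler_dist_normc (x y : K[i]) : `|nc x - nc y| <= nc (x + y).
Proof.
rewrite ler_norml ler_normc_sub andbT lerNl opprB [x + y]addrC.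
exact: ler_normc_sub.
Qed.

Lemma normc_prod (I : Type) (s : seq I) (f : I -> K[i]) :
  nc (\prod_(i <- s) f i) = \prod_(i <- s) nc (f i).
Proof.
by apply: (big_morph nc) => [x y|]; rewrite ?Normc.normcM ?Normc.normc1.
Qed.

Lemma normc_exp (z : K[i]) n : nc (z ^+ n) = nc z ^+ n.
Proof.
by elim: n => [|n IH]; rewrite ?Normc.normc1 // !exprS Normc.normcM IH.
Qed.

Lemma normc_horner (p : {poly K[i]}) z r : nc z <= r ->
  nc p.[z] <= wnorm nc r p.
Proof. exact: (sn_horner ncH). Qed.

(** The derivative on the disc of radius r is bounded by the weighted norm of
    radius r + 1, since i * r ^ (i - 1) <= (r + 1) ^ i. *)
Lemma horner_lipschitz (p : {poly K[i]}) z z' r : nc z <= r -> nc z' <= r ->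
  nc (p.[z] - p.[z']) <= wnorm nc (r + 1) p * nc (z - z').
Proof.
move=> zr z'r; have r0 := le_trans (normc_ge0 z) zr.
have pow i : nc (z ^+ i - z' ^+ i) <= (r + 1) ^+ i * nc (z - z').
  elim: i => [|i IH].
    by rewrite !expr0 subrr Normc.normc0 mul1r normc_ge0.
  have -> : z ^+ i.+1 - z' ^+ i.+1 =
      z * (z ^+ i - z' ^+ i) + z' ^+ i * (z - z').
    by rewrite !exprS; ring.
  apply: le_trans (le_normcD _ _) _.
  rewrite !Normc.normcM exprS mulrDl mul1r mulrDl.
  apply: lerD.
    by rewrite -mulrA ler_pM ?normc_ge0.
  rewrite ler_wpM2r ?normc_ge0 // normc_exp lerXn2r ?nnegrE ?normc_ge0 //.
    by rewrite addr_ge0.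
  by rewrite (le_trans z'r) // lerDl.
rewrite !horner_coef -sumrB.
have -> : wnorm nc (r + 1) p = \sum_(i < size p) nc p`_i * (r + 1) ^+ i.
  rewrite /wnorm (horner_coef_wide (n := size p)); last exact: size_poly.
  by apply: eq_bigr => i _; rewrite (coef_wnorm ncH).
apply: le_trans (sn_sum ncH _ _ _) _; rewrite mulr_suml; apply: ler_sum => i _.
by rewrite -mulrBr Normc.normcM -mulrA ler_wpM2l ?normc_ge0.
Qed.

Lemma ler_distcD (x y z : K[i]) : nc (x - z) <= nc (x - y) + nc (y - z).
Proof. by rewrite -[x - z](subrKA y) le_normcD. Qed.

Lemma disc_normc (z z0 : K[i]) r : nc (z - z0) <= r -> nc z <= nc z0 + r.
Proof.
by move=> zr; rewrite -[z](subrK z0) addrC (le_trans (le_normcD _ _)) ?lerD2l.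
Qed.

Lemma poly_split (p : {poly K[i]}) : exists s,
  p = lead_coef p *: \prod_(x <- s) ('X - x%:P) /\ forall x, x \in s -> root p x.
Proof.
have [s E] := closed_field_poly_normal p; exists s; split=> // x xs.
rewrite E; have [p0|p0] := eqVneq (lead_coef p) 0.
  by rewrite p0 scale0r root0.
by rewrite rootZ // root_prod_XsubC.
Qed.

(** Each linear factor at most doubles between z0 and z, since its root is farther
    from z0 than z is. *)
Lemma no_root_growth (p : {poly K[i]}) z0 z r :
  (forall x, root p x -> r < nc (x - z0)) -> nc (z - z0) <= r ->
  nc p.[z] <= 2 ^+ size p * nc p.[z0].
Proof.
move=> far zr; have [s [E rs]] := poly_split p.
have [p0|p0] := eqVneq p 0.
  by rewrite p0 !horner0 Normc.normc0 mulr0.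
have sz : (size s <= size p)%N.
  by rewrite E size_scale ?lead_coef_eq0 // size_prod_XsubC leqnSn.
have two_le : 2 ^+ size s <= 2 ^+ size p :> K.
  by rewrite ler_eXn2l // ltr1n.
apply: le_trans (_ : 2 ^+ size s * nc p.[z0] <= _); last first.
  by rewrite ler_wpM2r ?normc_ge0.
rewrite [in nc p.[z]]E [in nc p.[z0]]E !hornerZ !Normc.normcM mulrCA.
rewrite ler_wpM2l ?normc_ge0 // !horner_prod !normc_prod.
elim: s rs {E sz two_le} => [|x s IH] rs; first by rewrite !big_nil expr0 mul1r.
rewrite !big_cons !hornerXsubC exprS mulrACA.
apply: ler_pM.
- exact: normc_ge0.
- by apply: prodr_ge0 => i _; apply: normc_ge0.
- have := far _ (rs x (mem_head _ _)); rewrite distcC => xr.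
  apply: le_trans (ler_distcD z z0 x) _; rewrite [_ * _]mulr_natl mulr2n.
  by rewrite lerD2r (le_trans zr) // ltW.
by apply: IH => y ys; apply: rs; rewrite inE ys orbT.
Qed.

Lemma no_root_lower_bound (p : {poly K[i]}) z0 r :
  (forall x, nc (x - z0) <= r -> ~~ root p x) -> 0 <= r ->
  exists2 m, 0 < m & forall z, nc (z - z0) <= r -> m <= nc p.[z].
Proof.
move=> far r0; have [s [E rs]] := poly_split p.
have p0 : p != 0.
  have := far z0; rewrite subrr Normc.normc0 => /(_ r0).
  by apply: contraNneq => ->; rewrite root0.
have {}far x : x \in s -> 0 < nc (x - z0) - r.
  move=> xs; rewrite subr_gt0 ltNge; apply/negP => /far.
  by rewrite rs.
exists (nc (lead_coef p) * \prod_(x <- s) (nc (x - z0) - r)).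
  rewrite mulr_gt0 ?normc_gt0 ?lead_coef_eq0 // big_seq.
  by apply: prodr_gt0 => x; apply: far.
move=> z zr; rewrite [in leRHS]E hornerZ Normc.normcM ler_wpM2l ?normc_ge0 //.
rewrite horner_prod normc_prod big_seq [leRHS]big_seq.
apply: ler_prod => x xs; rewrite ltW ?far //= hornerXsubC lerBlDr.
by apply: le_trans (ler_distcD x z z0) _; rewrite (distcC x z) lerD2l.
Qed.

Section PerturbedRoot.
Variables (z0 : K[i]) (h T H : {poly K[i]}) (r m Q e : K) (s : nat).
Local Notation disc z := (nc (z - z0) <= r).
Local Notation N := (wnorm nc (nc z0 + r + 1)).
Hypotheses (r0 : 0 < r) (m0 : 0 < m) (h_ge : forall z, disc z -> m <= nc h.[z]).
Hypotheses (hQ : N h <= Q) (TQ : N T <= Q) (HQ : N H <= Q).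
Hypotheses (e0 : 0 < e) (e1 : e <= 1).

Let g : {poly K[i]} :=
  ('X - z0%:P) * h + (e%:C)%:P * T + (e%:C)%:P ^+ 2 * H.

Definition first_order_cst := Q * (2 * Q / m) ^+ 2 + Q * (2 * Q / m) + Q.

Let Q0 : 0 <= Q.
Proof.
apply: le_trans hQ; apply: sn_ge0 (submultiplicative_wnorm ncH _) _.
by rewrite !addr_ge0 ?normc_ge0 // ltW.
Qed.

Let bound p z : disc z -> N p <= Q -> nc p.[z] <= Q.
Proof.
move=> /disc_normc zr; apply: le_trans; apply: normc_horner.
by apply: le_trans zr _; rewrite lerDl.
Qed.

Let lip p z z' : disc z -> disc z' -> N p <= Q ->
  nc (p.[z] - p.[z']) <= Q * nc (z - z').
Proof.
move=> /disc_normc zr /disc_normc z'r pQ.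
apply: le_trans (horner_lipschitz p zr z'r) _.
by rewrite ler_wpM2r ?normc_ge0.
Qed.

Let disc0 : disc z0. Proof. by rewrite subrr Normc.normc0 ltW. Qed.

Let gE z : g.[z] = (z - z0) * h.[z] + e%:C * (T.[z] + e%:C * H.[z]).
Proof.
by rewrite /g !hornerD !hornerM hornerXsubC !hornerC; ring.
Qed.

Let nce : nc e%:C = e. Proof. by rewrite normc_real gtr0_norm. Qed.

Let boundU z : disc z -> nc (e%:C * (T.[z] + e%:C * H.[z])) <= 2 * Q * e.
Proof.
move=> dz; rewrite Normc.normcM nce mulrC ler_wpM2r ?(ltW e0) //.
apply: le_trans (le_normcD _ _) _; rewrite Normc.normcM nce mulr_natl mulr2n.
rewrite lerD ?bound // -[leRHS]mul1r ler_pM ?normc_ge0 ?bound ?(ltW e0) //.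
Qed.

Lemma perturbed_root_close z : disc z -> root g z ->
  nc (z - z0) <= 2 * Q / m * e.
Proof.
move=> dz /rootP; rewrite gE => /eqP; rewrite addr_eq0 => /eqP gz.
rewrite mulrAC ler_pdivlMr //; apply: le_trans (boundU dz).
rewrite -(normcN (_ * (_ + _))) -gz Normc.normcM.
by rewrite ler_wpM2l ?normc_ge0 ?h_ge.
Qed.

(** Expanding at z0, the remainder is quadratic because the root itself moves by
    O(e). *)
Lemma perturbed_root_first_order z : disc z -> root g z ->
  `|nc (z - z0) * nc h.[z0] - e * nc T.[z0]| <= first_order_cst * e ^+ 2.
Proof.
move=> dz gz; have zc := perturbed_root_close dz gz.
move/rootP: gz; rewrite gE => gz.
have -> : nc (z - z0) * nc h.[z0] - e * nc T.[z0] =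
    nc ((z - z0) * h.[z0]) - nc (e%:C * T.[z0]) by rewrite !Normc.normcM nce.
apply: le_trans (ler_dist_normc _ _) _.
have -> : (z - z0) * h.[z0] + e%:C * T.[z0] =
    (z - z0) * (h.[z0] - h.[z]) + (e%:C * (T.[z0] - T.[z]) - e%:C ^+ 2 * H.[z]).
  by rewrite -[LHS]subr0 -gz; ring.
set c := 2 * Q / m in zc.
have c0 : 0 <= c * e by apply: le_trans zc; apply: normc_ge0.
rewrite /first_order_cst -/c.
have hz : nc (h.[z0] - h.[z]) <= Q * (c * e).
  by rewrite (le_trans (lip _ _ hQ)) // ler_wpM2l // distcC.
have tz : nc (T.[z0] - T.[z]) <= Q * (c * e).
  by rewrite (le_trans (lip _ _ TQ)) // ler_wpM2l // distcC.
apply: le_trans (le_normcD _ _) _.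
have -> : (Q * c ^+ 2 + Q * c + Q) * e ^+ 2 =
  (c * e) * (Q * (c * e)) + (e * (Q * (c * e)) + e ^+ 2 * Q) by ring.
apply: lerD; first by rewrite Normc.normcM ler_pM ?normc_ge0.
apply: le_trans (le_normcD _ _) _; rewrite normcN !Normc.normcM nce.
apply: lerD; first by rewrite ler_wpM2l // ltW.
by rewrite -expr2 ler_wpM2l ?bound // exprn_ge0 // ltW.
Qed.

(** Two roots in the disc would make a divided difference vanish that is within
    O(e) of h, which is bounded below. *)
Lemma perturbed_root_unique z z' : (2 * Q ^+ 2 / m + 2 * Q) * e < m ->
  disc z -> disc z' -> root g z -> root g z' -> z = z'.
Proof.
move=> em dz dz' gz gz'; have zc := perturbed_root_close dz' gz'.
move/rootP: gz; move/rootP: gz'; rewrite !gE => gz' gz.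
apply/eqP; rewrite -subr_eq0; apply: contraTT em => zz'.
rewrite -leNgt; have d0 : 0 < nc (z - z') by rewrite normc_gt0.
rewrite -(ler_pM2r d0).
have E : (z - z') * h.[z] = - ((z' - z0) * (h.[z] - h.[z'])
   + e%:C * ((T.[z] - T.[z']) + e%:C * (H.[z] - H.[z']))).
  apply/eqP; rewrite -subr_eq0 -(subrr 0) -{1}gz -{1}gz'; apply/eqP; ring.
apply: le_trans (_ : nc ((z - z') * h.[z]) <= _).
  by rewrite Normc.normcM mulrC ler_wpM2l ?normc_ge0 ?h_ge.
rewrite E normcN; apply: le_trans (le_normcD _ _) _; rewrite !Normc.normcM nce.
set d := nc (z - z') in d0 *.
have hz : nc (h.[z] - h.[z']) <= Q * d by apply: lip.
have tz : nc (T.[z] - T.[z'] + e%:C * (H.[z] - H.[z'])) <= 2 * Q * d.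
  apply: le_trans (le_normcD _ _) _; rewrite Normc.normcM nce.
  rewrite -mulrA mulr_natl mulr2n lerD ?lip // -[leRHS]mul1r.
  by rewrite ler_pM ?normc_ge0 ?lip // ltW.
have -> : (2 * Q ^+ 2 / m + 2 * Q) * e * d =
    (2 * Q / m * e) * (Q * d) + e * (2 * Q * d).
  by ring.
by apply: lerD; [rewrite ler_pM ?normc_ge0 | rewrite ler_wpM2l // ltW].
Qed.

(** The perturbed polynomial is O(e) at z0 but bounded below at distance r / 2:
    this growth is impossible without roots in the smaller disc. *)
Lemma perturbed_root_exists : (size g <= s)%N ->
  (2 ^+ s + 1) * (2 * Q) * e < r / 2 * m ->
  exists2 z, nc (z - z0) < r & root g z.
Proof.
move=> gs em; apply: contrapT => none.
have r2 : 0 < r / 2 by rewrite divr_gt0.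
have r2r : r / 2 < r by lra.
pose z1 := z0 + (r / 2)%:C.
have z1E : z1 - z0 = (r / 2)%:C by rewrite /z1 addrC addKr.
have nz1 : nc (z1 - z0) = r / 2 by rewrite z1E normc_real gtr0_norm.
have dz1 : disc z1 by rewrite nz1 ltW.
have far x : root g x -> r / 2 < nc (x - z0).
  move=> gx; rewrite ltNge; apply/negP => xr; apply: none.
  by exists x => //; apply: le_lt_trans xr _.
have le1 : nc (z1 - z0) <= r / 2 by rewrite nz1.
have := no_root_growth far le1.
rewrite [in nc g.[z0]]gE subrr mul0r add0r => up.
have low : r / 2 * m - 2 * Q * e <= nc g.[z1].
  rewrite gE; apply: le_trans (ler_normc_sub _ _).
  apply: lerB; last exact: boundU.
  by rewrite Normc.normcM nz1 ler_wpM2l ?h_ge // ltW.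
have up2 : nc g.[z1] <= 2 ^+ s * (2 * Q * e).
  apply: le_trans up _; apply: ler_pM; rewrite ?normc_ge0 ?exprn_ge0 ?boundU //.
  by rewrite ler_eXn2l // ltr1n.
move: em; rewrite ltNge => /negP; apply.
have := le_trans low up2; rewrite lerBlDr => /le_trans; apply.
by rewrite le_eqVlt; apply/orP; left; apply/eqP; ring.
Qed.

End PerturbedRoot.
End Perturbation.

(** * Euclidean and spectral norms *)

Section Norms.
Context {K : realType}.
Local Notation nc := (@Normc.normc K).
Local Open Scope complex_scope.
Local Open Scope classical_set_scope.

Lemma sqr_sum_ge0 (I J : finType) (f : I -> J -> K) :
  0 <= \sum_i \sum_j f i j ^+ 2.
Proof. by apply: sumr_ge0 => i _; apply: sumr_ge0 => j _; apply: sqr_ge0. Qed.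

Lemma vnorm2_ge0 m n (u : 'M[K[i]]_(m, n)) : 0 <= vnorm2 u.
Proof. exact: sqrtr_ge0. Qed.

Lemma sqr_vnorm2 m n (u : 'M[K[i]]_(m, n)) :
  vnorm2 u ^+ 2 = \sum_i \sum_j nc (u i j) ^+ 2.
Proof. by rewrite sqr_sqrtr // sqr_sum_ge0. Qed.

Lemma sqr_vnorm2_row n (r : 'rV[K[i]]_n) :
  vnorm2 r ^+ 2 = \sum_j nc (r 0 j) ^+ 2.
Proof. by rewrite sqr_vnorm2 big_ord1. Qed.

Lemma sqr_vnorm2_col n (s : 'cV[K[i]]_n) :
  vnorm2 s ^+ 2 = \sum_j nc (s j 0) ^+ 2.
Proof. by rewrite sqr_vnorm2; apply: eq_bigr => i _; rewrite big_ord1. Qed.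

Lemma vnorm2_eq0 m n (u : 'M[K[i]]_(m, n)) : vnorm2 u = 0 -> u = 0.
Proof.
move=> u0; have /eqP := sqr_vnorm2 u.
rewrite u0 expr0n eq_sym psumr_eq0 => [/allP e|i _]; last first.
  by apply: sumr_ge0 => j _; apply: sqr_ge0.
apply/matrixP => i j; rewrite mxE; apply: Normc.eq0_normc.
have := e i (mem_index_enum _).
rewrite /= psumr_eq0 => [/allP|? _]; last exact: sqr_ge0.
by move=> /(_ j (mem_index_enum _)) /=; rewrite sqrf_eq0 => /eqP.
Qed.

Lemma vnorm2Z m n (c : K[i]) (u : 'M[K[i]]_(m, n)) :
  vnorm2 (c *: u) = nc c * vnorm2 u.
Proof.
rewrite /vnorm2 -[nc c in RHS]ger0_norm ?normc_ge0 //.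
rewrite -sqrtr_sqr -sqrtrM ?sqr_ge0 //.
congr Num.sqrt; rewrite mulr_sumr; apply: eq_bigr => i _; rewrite mulr_sumr.
by apply: eq_bigr => j _; rewrite mxE Normc.normcM exprMn.
Qed.

Lemma vnorm2N m n (u : 'M[K[i]]_(m, n)) : vnorm2 (- u) = vnorm2 u.
Proof.
congr Num.sqrt; apply: eq_bigr => i _; apply: eq_bigr => j _.
by rewrite mxE normcN.
Qed.

Lemma vnorm2_0 m n : vnorm2 (0 : 'M[K[i]]_(m, n)) = 0.
Proof. by rewrite -(scale0r 0) vnorm2Z Normc.normc0 mul0r. Qed.

Lemma ler_entry_vnorm2 m n (u : 'M[K[i]]_(m, n)) i j : nc (u i j) <= vnorm2 u.
Proof.
rewrite -[leLHS]ger0_norm ?normc_ge0 // -sqrtr_sqr ler_wsqrtr //.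
rewrite (bigD1 i) //= (bigD1 j) //= -addrA lerDl addr_ge0 //.
  by apply: sumr_ge0 => *; apply: sqr_ge0.
by apply: sumr_ge0 => *; apply: sumr_ge0 => *; apply: sqr_ge0.
Qed.

Lemma cauchy_schwarz_row_col n (r : 'rV[K[i]]_n) (s : 'cV[K[i]]_n) :
  nc ((r *m s) 0 0) <= vnorm2 r * vnorm2 s.
Proof.
have [r0|r0] := eqVneq (vnorm2 r) 0.
  by rewrite (vnorm2_eq0 r0) mul0mx mxE Normc.normc0 vnorm2_0 mul0r.
have [s0|s0] := eqVneq (vnorm2 s) 0.
  by rewrite (vnorm2_eq0 s0) mulmx0 mxE Normc.normc0 vnorm2_0 mulr0.
have rp : 0 < vnorm2 r by rewrite lt_def r0 vnorm2_ge0.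
have sp : 0 < vnorm2 s by rewrite lt_def s0 vnorm2_ge0.
set a := vnorm2 r in r0 rp *; set b := vnorm2 s in s0 sp *.
rewrite mxE; apply: le_trans (sn_sum normc_submultiplicative _ _ _) _.
(* termwise 2 x y <= (b / a) x ^ 2 + (a / b) y ^ 2 *)
apply: le_trans (_ : \sum_j ((b / a) * nc (r 0 j) ^+ 2 / 2
                           + (a / b) * nc (s j 0) ^+ 2 / 2) <= _).
  apply: ler_sum => j _; rewrite Normc.normcM.
  set x := nc _; set y := nc _.
  have : 0 <= (b * x - a * y) ^+ 2 / (a * b).
    by rewrite divr_ge0 ?sqr_ge0 ?mulr_ge0 ?ltW.
  have -> : (b * x - a * y) ^+ 2 / (a * b) =
      b / a * x ^+ 2 + a / b * y ^+ 2 - 2 * (x * y) by field; rewrite r0 s0.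
  lra.
rewrite big_split /= -!mulr_suml -!mulr_sumr.
rewrite -sqr_vnorm2_row -sqr_vnorm2_col -/a -/b.
by rewrite le_eqVlt; apply/orP; left; apply/eqP; field; rewrite r0 s0.
Qed.

Lemma vnorm2_mulmx m n (M : 'M[K[i]]_(m, n)) (u : 'cV[K[i]]_n) :
  vnorm2 (M *m u) <= vnorm2 M * vnorm2 u.
Proof.
rewrite -ler_sqr ?nnegrE ?mulr_ge0 ?vnorm2_ge0 // exprMn sqr_vnorm2_col.
rewrite [vnorm2 M ^+ 2]sqr_vnorm2 mulr_suml; apply: ler_sum => i _.
have -> : (M *m u) i 0 = (row i M *m u) 0 0.
  by rewrite !mxE; apply: eq_bigr => j _; rewrite mxE.
have -> : \sum_j nc (M i j) ^+ 2 = vnorm2 (row i M) ^+ 2.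
  by rewrite sqr_vnorm2_row; apply: eq_bigr => j _; rewrite mxE.
rewrite -exprMn ler_sqr ?nnegrE ?mulr_ge0 ?vnorm2_ge0 ?normc_ge0 //.
exact: cauchy_schwarz_row_col.
Qed.

Lemma mxnorm2_ub m n (M : 'M[K[i]]_(m, n)) (u : 'cV[K[i]]_n) : vnorm2 u <= 1 ->
  vnorm2 (M *m u) <= mxnorm2 M.
Proof.
move=> u1; apply: ub_le_sup; last by exists u.
exists (vnorm2 M) => _ [w /= w1 <-]; apply: le_trans (vnorm2_mulmx _ _) _.
by rewrite ler_piMr ?vnorm2_ge0.
Qed.

Lemma mxnorm2_ge0 m n (M : 'M[K[i]]_(m, n)) : 0 <= mxnorm2 M.
Proof.
apply: le_trans (vnorm2_ge0 (M *m 0)) (mxnorm2_ub M (u := 0) _).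
by rewrite vnorm2_0 ler01.
Qed.

Lemma mxnorm2_le m n (M : 'M[K[i]]_(m, n)) c :
  (forall u : 'cV[K[i]]_n, vnorm2 u <= 1 -> vnorm2 (M *m u) <= c) ->
  mxnorm2 M <= c.
Proof.
move=> Mc; apply: ge_sup; last by move=> _ [u u1 <-]; apply: Mc.
by exists (vnorm2 (M *m (0 : 'cV[K[i]]_n))), 0; rewrite //= vnorm2_0.
Qed.

Lemma ler_mulmx_mxnorm2 m n (M : 'M[K[i]]_(m, n)) (u : 'cV[K[i]]_n) :
  vnorm2 (M *m u) <= mxnorm2 M * vnorm2 u.
Proof.
have [u0|u0] := eqVneq (vnorm2 u) 0.
  by rewrite (vnorm2_eq0 u0) mulmx0 !vnorm2_0 mulr0.
have up : 0 < vnorm2 u by rewrite lt_def u0 vnorm2_ge0.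
have -> : vnorm2 (M *m u) = vnorm2 (M *m ((vnorm2 u)^-1%:C *: u)) * vnorm2 u.
  rewrite -scalemxAr vnorm2Z normc_real gtr0_norm ?invr_gt0 //.
  by rewrite mulrAC mulVf ?mul1r.
rewrite ler_wpM2r ?vnorm2_ge0 // mxnorm2_ub //.
by rewrite vnorm2Z normc_real gtr0_norm ?invr_gt0 // mulVf.
Qed.

Lemma ler_bilinear_mxnorm2 m n (M : 'M[K[i]]_(m, n)) (r : 'rV[K[i]]_m)
    (s : 'cV[K[i]]_n) :
  nc ((r *m M *m s) 0 0) <= mxnorm2 M * (vnorm2 r * vnorm2 s).
Proof.
rewrite -mulmxA; apply: le_trans (cauchy_schwarz_row_col _ _) _.
by rewrite mulrCA ler_wpM2l ?vnorm2_ge0 ?ler_mulmx_mxnorm2.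
Qed.

Lemma ler_entry_mxnorm2 m n (M : 'M[K[i]]_(m, n)) i j : nc (M i j) <= mxnorm2 M.
Proof.
have -> : M i j = (M *m delta_mx j (0 : 'I_1)) i 0 by rewrite -colE mxE.
apply: le_trans (ler_entry_vnorm2 _ _ _) (mxnorm2_ub _ _).
rewrite -[leRHS]sqrtr1 ler_wsqrtr // (bigD1 j) //= big_ord1 mxE !eqxx.
rewrite Normc.normc1.
rewrite big1 => [|k kj]; first by rewrite expr1n addr0.
by rewrite big_ord1 mxE (negPf kj) Normc.normc0 expr0n.
Qed.

Lemma mxnorm2Z_le m n (c : K[i]) (M : 'M[K[i]]_(m, n)) :
  mxnorm2 (c *: M) <= nc c * mxnorm2 M.
Proof.
apply: mxnorm2_le => u u1; rewrite -scalemxAl vnorm2Z ler_wpM2l ?normc_ge0 //.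
exact: mxnorm2_ub.
Qed.

(** The rank-one matrix for which Cauchy-Schwarz is an equality on both sides. If
    r or s vanishes the inverse is 0, and so is the matrix. *)
Definition aligned m n (r : 'rV[K[i]]_m) (s : 'cV[K[i]]_n) : 'M[K[i]]_(m, n) :=
  (vnorm2 r * vnorm2 s)^-1%:C *: (map_mx conjc r^T *m map_mx conjc s^T).

Lemma mulr_conjc (z : K[i]) : z * conjc z = (nc z ^+ 2)%:C.
Proof.
by rewrite -sqr_normc normc_def rmorphXn /=; case: z.
Qed.

Lemma normc_conjc (z : K[i]) : nc (conjc z) = nc z.
Proof. by case: z => a b; rewrite /= sqrrN. Qed.

Lemma vnorm2_adj m n (M : 'M[K[i]]_(m, n)) :
  vnorm2 (map_mx conjc M^T) = vnorm2 M.
Proof.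
rewrite /vnorm2 exchange_big; congr Num.sqrt.
by apply: eq_bigr => i _; apply: eq_bigr => j _; rewrite !mxE normc_conjc.
Qed.

Lemma mul_row_adj n (r : 'rV[K[i]]_n) :
  r *m map_mx conjc r^T = (vnorm2 r ^+ 2)%:C%:M.
Proof.
rewrite [LHS]mx11_scalar; congr _%:M; rewrite mxE sqr_vnorm2_row rmorph_sum /=.
by apply: eq_bigr => j _; rewrite !mxE mulr_conjc.
Qed.

Lemma mul_adj_col n (s : 'cV[K[i]]_n) :
  map_mx conjc s^T *m s = (vnorm2 s ^+ 2)%:C%:M.
Proof.
rewrite [LHS]mx11_scalar; congr _%:M; rewrite mxE sqr_vnorm2_col rmorph_sum /=.
by apply: eq_bigr => j _; rewrite !mxE mulrC mulr_conjc.
Qed.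

Lemma aligned_bilinear m n (r : 'rV[K[i]]_m) (s : 'cV[K[i]]_n) :
  r *m aligned r s *m s = (vnorm2 r * vnorm2 s)%:C%:M.
Proof.
rewrite /aligned -scalemxAr -scalemxAl [r *m _]mulmxA -mulmxA.
rewrite mul_row_adj mul_adj_col.
rewrite -scalar_mxM scale_scalar_mx -!rmorphM /=; congr (_%:C)%:M.
have [->|a0] := eqVneq (vnorm2 r * vnorm2 s) 0; first by rewrite invr0 mul0r.
by rewrite -exprMn expr2 mulKf.
Qed.

Lemma mxnorm2_aligned m n (r : 'rV[K[i]]_m) (s : 'cV[K[i]]_n) :
  mxnorm2 (aligned r s) <= 1.
Proof.
apply: mxnorm2_le => u u1; set a := vnorm2 r * vnorm2 s.
have a0 : 0 <= a by rewrite mulr_ge0 ?vnorm2_ge0.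
rewrite /aligned -/a -scalemxAl -mulmxA vnorm2Z normc_real.
rewrite ger0_norm ?invr_ge0 //.
rewrite [map_mx conjc s^T *m u]mx11_scalar mul_mx_scalar vnorm2Z vnorm2_adj.
have le1 : nc ((map_mx conjc s^T *m u) 0 0) <= vnorm2 s.
  apply: le_trans (cauchy_schwarz_row_col _ _) _.
  by rewrite vnorm2_adj ler_piMr ?vnorm2_ge0.
apply: le_trans (_ : a^-1 * a <= _).
  by rewrite ler_wpM2l ?invr_ge0 // mulrC ler_wpM2l ?vnorm2_ge0.
have [->|an0] := eqVneq a 0; first by rewrite mulr0 ler01.
by rewrite mulVf.
Qed.

(** * Weighted perturbations *)

Section Weights.
Variables (k m n : nat) (w : 'I_k.+1 -> K) (z : K[i]).
Variables (r : 'rV[K[i]]_m) (s : 'cV[K[i]]_n).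
Local Notation weight z := (\sum_i w i * nc z ^+ i).

Lemma pm_eval_grade (dM : 'M[{poly K[i]}]_(m, n)) : has_grade k dM ->
  pm_eval dM z = \sum_(i < k.+1) z ^+ i *: pm_coef dM i.
Proof.
move=> gr; apply/matrixP => j l; rewrite summxE mxE.
rewrite (horner_coef_wide z (gr j l)); apply: eq_bigr => i _.
by rewrite !mxE mulrC.
Qed.

Lemma admissible_bilinear (dM : 'M[{poly K[i]}]_(m, n)) : admissible w dM ->
  nc ((r *m pm_eval dM z *m s) 0 0) <= weight z * (vnorm2 r * vnorm2 s).
Proof.
case=> gr wM; rewrite (pm_eval_grade gr) mulmx_sumr mulmx_suml summxE.
apply: le_trans (sn_sum normc_submultiplicative _ _ _) _.
rewrite mulr_suml; apply: ler_sum => i _.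
rewrite -scalemxAr -scalemxAl mxE Normc.normcM normc_exp.
rewrite [leRHS]mulrAC [leRHS]mulrC.
rewrite ler_wpM2l ?exprn_ge0 ?normc_ge0 //.
apply: le_trans (ler_bilinear_mxnorm2 _ _ _) _.
by rewrite ler_wpM2r ?mulr_ge0 ?vnorm2_ge0.
Qed.

Lemma admissible_wnorm (dM : 'M[{poly K[i]}]_(m, n)) rho j l : 0 <= rho ->
  admissible w dM -> wnorm nc rho (dM j l) <= \sum_i w i * rho ^+ i.
Proof.
move=> rho0 [gr wM]; rewrite /wnorm (horner_coef_wide (n := k.+1)); last first.
  by apply: leq_trans (gr j l); apply: size_poly.
apply: ler_sum => i _; rewrite (coef_wnorm normc_submultiplicative).
rewrite ler_wpM2r ?exprn_ge0 //; apply: le_trans (wM i).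
by have := ler_entry_mxnorm2 (pm_coef dM i) j l; rewrite mxE.
Qed.

Lemma unit_phase : exists2 u : K[i], nc u = 1 & u * z = (nc z)%:C.
Proof.
have [->|z0] := eqVneq z 0.
  by exists 1; rewrite ?Normc.normc1 // mulr0 Normc.normc0.
have nz : nc z != 0 by rewrite gt_eqF // normc_gt0.
exists ((nc z)^-1%:C * conjc z).
  rewrite Normc.normcM normc_conjc normc_real.
  by rewrite ger0_norm ?invr_ge0 ?normc_ge0 // mulVf.
by rewrite -mulrA [_ * z]mulrC mulr_conjc -rmorphM /= expr2 mulKf.
Qed.

(** All coefficients are taken aligned with r and s, and rotated by the phases
    that make their contributions at z add up. *)
Lemma admissible_extremal : (forall i, 0 <= w i) ->
  exists2 dM : 'M[{poly K[i]}]_(m, n), admissible w dM &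
    r *m pm_eval dM z *m s = (weight z * (vnorm2 r * vnorm2 s))%:C%:M.
Proof.
move=> w0; have [u u1 uz] := unit_phase.
pose c (i : 'I_k.+1) := (w i)%:C * u ^+ i.
pose dM : 'M[{poly K[i]}]_(m, n) :=
  \matrix_(j, l) \poly_(i < k.+1) (c (inord i) * aligned r s j l).
have gr : has_grade k dM by move=> j l; rewrite mxE size_poly.
have coefE (i : 'I_k.+1) : pm_coef dM i = c i *: aligned r s.
  by apply/matrixP => j l; rewrite !mxE coef_poly ltn_ord inord_val.
exists dM.
  split=> // i; rewrite coefE; apply: le_trans (mxnorm2Z_le _ _) _.
  rewrite -[leRHS]mulr1.
  apply: ler_pM; rewrite ?normc_ge0 ?mxnorm2_ge0 ?mxnorm2_aligned //.
  by rewrite Normc.normcM normc_exp u1 expr1n mulr1 normc_real ger0_norm.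
rewrite (pm_eval_grade gr).
have -> : \sum_(i < k.+1) z ^+ i *: pm_coef dM i = (weight z)%:C *: aligned r s.
  rewrite rmorph_sum scaler_suml; apply: eq_bigr => i _.
  rewrite coefE scalerA rmorphM rmorphXn /= -uz /c exprMn; congr (_ *: _).
  by rewrite mulrC -mulrA.
rewrite -scalemxAr -scalemxAl aligned_bilinear scale_scalar_mx.
by rewrite [in RHS]rmorphM.
Qed.

End Weights.
End Norms.

(** * Perturbation of a simple eigenvalue of a polynomial matrix *)

Section SimpleEigenvalue.
Context {F : fieldType}.

(** By Jacobi's formula the derivatives of the determinant are traces against the
    adjugate, which is c times the product of the two eigenvectors. The constant c
    cancels in the quotient that gives the velocity of the eigenvalue. *)
Lemma simple_eigenvalue_gradient m (P : 'M[{poly F}]_m) (h : {poly F}) z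
    (v : 'cV[F]_m) (w : 'rV[F]_m) :
  \det P = ('X - z%:P) * h -> h.[z] != 0 -> v != 0 -> w != 0 ->
  pm_eval P z *m v = 0 -> w *m pm_eval P z = 0 ->
  exists c, h.[z] = c * (w *m pm_eval (pm_deriv P) z *m v) 0 0 /\
    forall E, (\tr (\adj P *m E)).[z] = c * (w *m pm_eval E z *m v) 0 0.
Proof.
move=> dP hz v0 w0 Pv wP.
have trE E : (\tr (\adj P *m E)).[z] = \tr (\adj (pm_eval P z) *m pm_eval E z).
  rewrite -pm_eval_adj -pm_evalM.
  exact: esym (trace_map_mx (horner_eval z) _).
have hE : h.[z] = (\tr (\adj P *m pm_deriv P)).[z].
  rewrite -deriv_det dP derivM derivXsubC mul1r hornerD hornerM hornerXsubC.
  by rewrite subrr mul0r addr0.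
have adj0 : \adj (pm_eval P z) != 0.
  by apply: contraNneq hz => a0; rewrite hE trE a0 mul0mx mxtrace0.
have [c cE] := adj_rank_one v0 w0 Pv wP adj0.
have trc E : (\tr (\adj P *m E)).[z] = c * (w *m pm_eval E z *m v) 0 0.
  rewrite trE cE -scalemxAl mxtraceZ.
  rewrite mxtrace_mulC mulmxA mxtrace_mulC mulmxA [X in \tr X]mx11_scalar.
  by rewrite mxtrace_scalar mulr1n.
by exists c; rewrite hE trc.
Qed.

End SimpleEigenvalue.

Lemma size_det_leq (R : comNzRingType) m (M : 'M[{poly R}]_m) s :
  (forall i j, (size (M i j) <= s)%N) -> (size (\det M) <= (m * s).+1)%N.
Proof.
move=> Ms; apply: leq_trans (size_sum _ _ _) _; apply/bigmax_leqP => t _.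
rewrite mulr_sign; case: (odd_perm t); rewrite ?size_polyN;
  apply: leq_trans (size_poly_prod_leq _ _) _; rewrite leq_subLR;
  apply: leq_trans (leq_addl _ _); rewrite ltnS -[m in (m * s)%N]card_ord;
  by rewrite -sum_nat_const; apply: leq_sum.
Qed.

Section Continuation.
Context {K : realType}.
Local Notation nc := (@Normc.normc K).
Local Open Scope complex_scope.
Variables (m : nat) (P : 'M[{poly K[i]}]_m).
Variables (z0 : K[i]) (h : {poly K[i]}) (r : K).
Hypotheses (dP : \det P = ('X - z0%:P) * h) (hz0 : h.[z0] != 0).
Hypothesis iso : isolating_radius P z0 r.
Local Notation N := (wnorm nc (nc z0 + r + 1)).

Let r0 : 0 < r. Proof. by case: iso. Qed.

Let HN : submultiplicative N.
Proof.
apply: (submultiplicative_wnorm normc_submultiplicative).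
by rewrite !addr_ge0 ?normc_ge0 // ltW.
Qed.

Lemma det_simple_neq0 : \det P != 0.
Proof.
rewrite dP mulf_neq0 ?polyXsubC_eq0 //.
by apply: contraNneq hz0 => ->; rewrite horner0.
Qed.

Lemma isolating_cofactor_lower_bound :
  exists2 mu, 0 < mu & forall z, nc (z - z0) <= r -> mu <= nc h.[z].
Proof.
apply: no_root_lower_bound (ltW r0) => z zr; apply/negP => hz.
have /(proj2 iso z zr) zz0 : zero_of (pm_ratmx P) z.
  by apply/zero_ofP; split; [exact: det_simple_neq0 | rewrite dP rootM hz orbT].
by move: hz; rewrite zz0 /root (negPf hz0).
Qed.

Lemma perturbed_det_expansion b (E : 'M[{poly K[i]}]_m) e :
  (forall i j, N (P i j) <= b) -> (forall i j, N (E i j) <= b) ->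
  0 < e -> e <= 1 ->
  exists H, [/\ N H <= m`!%:R * (b + b) ^+ m,
    N (\tr (\adj P *m E)) <= m`!%:R * (b + b) ^+ m &
    \det (P + (e%:C)%:P *: E) =
      ('X - z0%:P) * h + (e%:C)%:P * \tr (\adj P *m E) + (e%:C)%:P ^+ 2 * H].
Proof.
move=> Pb Eb e0 e1; rewrite -dP; apply: det_expansion => //.
by rewrite (wnormC normc_submultiplicative) normc_real gtr0_norm.
Qed.

Lemma finite_bound (E : 'M[{poly K[i]}]_m) i j :
  N (E i j) <= \sum_i \sum_j N (E i j).
Proof.
rewrite (bigD1 i) //= (bigD1 j) //=.
apply: ler_wpDr.
  by apply: sumr_ge0 => *; apply: sumr_ge0 => *; apply: sn_ge0.
by apply: ler_wpDr; first by apply: sumr_ge0 => *; apply: sn_ge0.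
Qed.

(** The constant depends on E only through the bound b, so that the estimate is
    uniform over all admissible perturbations. *)
Lemma eigenvalue_first_order b : exists Cst,
  forall (E : 'M[{poly K[i]}]_m) e z, (forall i j, N (E i j) <= b) ->
    0 < e -> e <= 1 ->
    nc (z - z0) <= r -> root (\det (P + (e%:C)%:P *: E)) z ->
    `|nc (z - z0) * nc h.[z0] - e * nc (\tr (\adj P *m E)).[z0]|
      <= Cst * e ^+ 2.
Proof.
have [mu mu0 h_ge] := isolating_cofactor_lower_bound.
pose b' := Num.max b (\sum_i \sum_j N (P i j)).
pose Q := Num.max (N h) (m`!%:R * (b' + b') ^+ m).
exists (first_order_cst mu Q) => E e z Eb e0 e1 zr.
have [| |H [HQ TQ ->] gz] := @perturbed_det_expansion b' E e _ _ e0 e1.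
- by move=> i j; rewrite le_max finite_bound orbT.
- by move=> i j; rewrite le_max Eb.
by apply: (perturbed_root_first_order r0 mu0 h_ge _ _ _ e0 e1 zr gz);
  rewrite le_max ?lexx ?HQ ?TQ ?orbT.
Qed.

Lemma small_enough (a b : K) : 0 <= a -> 0 < b ->
  exists2 e0, 0 < e0 & forall e, e < e0 -> a * e < b.
Proof.
move=> a0 b0; exists (b / (a + 1)) => [|e].
  by rewrite divr_gt0 // ltr_wpDl.
rewrite ltr_pdivlMr ?ltr_wpDl //.
have [e_ge0|e_lt0] := leP 0 e; first by nra.
by move=> _; nra.
Qed.

Lemma eigenvalue_continuation (E : 'M[{poly K[i]}]_m) :
  exists2 e0, 0 < e0 & forall e, 0 < e -> e < e0 ->
    exists z, unique_zero_in_disc (P + (e%:C)%:P *: E) z0 r z.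
Proof.
have [mu mu0 h_ge] := isolating_cofactor_lower_bound.
pose b := Num.max (\sum_i \sum_j N (E i j)) (\sum_i \sum_j N (P i j)).
pose Q := Num.max (N h) (m`!%:R * (b + b) ^+ m).
have Q0 : 0 <= Q by rewrite le_max (sn_ge0 HN).
pose s0 := (\sum_i \sum_j (size (P i j) + size (E i j)))%N.
pose s := (m * s0).+1.
have Es i j : (size (P i j) + size (E i j) <= s0)%N.
  by rewrite /s0 (bigD1 i) //= (bigD1 j) //= -[X in (_ <= X)%N]addnA leq_addr.
have [||e1 e1_gt0 He1] := @small_enough (2 * Q ^+ 2 / mu + 2 * Q) mu.
- have mu_ge0 := ltW mu0.
  by rewrite addr_ge0 ?mulr_ge0 ?invr_ge0 ?sqr_ge0.
- by [].
have [||e2 e2_gt0 He2] := @small_enough ((2 ^+ s + 1) * (2 * Q)) (r / 2 * mu).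
- by rewrite !mulr_ge0 ?addr_ge0 ?exprn_ge0.
- by rewrite mulr_gt0 // divr_gt0.
exists (Num.min 1 (Num.min e1 e2)); first by rewrite !lt_min ltr01 e1_gt0.
move=> e e0; rewrite !lt_min => /and3P[/ltW e_le1 /He1 ee1 /He2 ee2].
have [| |H [HQ TQ dE]] := @perturbed_det_expansion b E e _ _ e0 e_le1.
- by move=> i j; rewrite le_max finite_bound orbT.
- by move=> i j; rewrite le_max finite_bound.
have {}HQ : N H <= Q by rewrite le_max HQ orbT.
have {}TQ : N (\tr (\adj P *m E)) <= Q by rewrite le_max TQ orbT.
have hQ : N h <= Q by rewrite le_max lexx.
have uniq z z' : nc (z - z0) <= r -> nc (z' - z0) <= r ->
    root (\det (P + (e%:C)%:P *: E)) z -> root (\det (P + (e%:C)%:P *: E)) z' ->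
    z = z'.
  rewrite dE => dz dz'.
  exact: (perturbed_root_unique mu0 h_ge hQ TQ HQ e0 e_le1 ee1 dz dz').
have [|z zr gz] := @perturbed_root_exists K z0 h _ H r mu Q e s
  r0 h_ge TQ HQ e0 e_le1 _ ee2.
  rewrite -dE; apply: size_det_leq => i j; rewrite !mxE.
  apply: leq_trans (Es i j); apply: leq_trans (size_polyD _ _) _.
  rewrite geq_max leq_addr mul_polyC.
  by apply: leq_trans (size_scale_leq _ _) (leq_addl _ _).
rewrite -dE in gz; exists z; split=> //.
  (* if the determinant were 0, uniqueness would identify any two points *)
  apply/zero_ofP; split=> //; apply/eqP => d0.
  have r2 : 0 < r / 2 by rewrite divr_gt0.
  have nr : nc (r / 2)%:C = r / 2 by rewrite normc_real gtr0_norm.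
  have : z0 = z0 + (r / 2)%:C.
    apply: uniq; rewrite ?d0 ?root0 // ?subrr ?Normc.normc0 ?ltW //.
    by rewrite addrC addKr nr ltr_pdivrMr // ltr_pMr // ltr1n.
  move/(congr1 (fun t => nc (t - z0)))/eqP.
  by rewrite subrr addrC addKr Normc.normc0 nr lt_eqF.
move=> z' z'r /zero_ofP[_ gz'].
by apply: uniq => //; apply: ltW.
Qed.

End Continuation.

(** * Isolation of the eigenvalue and passage to the limit *)

Section Limits.
Context {K : realType}.
Local Open Scope classical_set_scope.
Local Open Scope complex_scope.

Lemma isolating_radius_exists m (P : 'M[{poly K[i]}]_m) z0 (h : {poly K[i]}) :
  \det P = ('X - z0%:P) * h -> h.[z0] != 0 -> exists r, isolating_radius P z0 r.
Proof.
move=> dP hz0; pose b := wnorm (@Normc.normc K) (Normc.normc z0 + 1 + 1) h.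
have h0 : 0 < Normc.normc h.[z0] by rewrite normc_gt0.
have b0 : 0 <= b.
  apply: sn_ge0 (submultiplicative_wnorm normc_submultiplicative _) _.
  by rewrite !addr_ge0 ?normc_ge0.
have [e0 e0_gt0 He] := small_enough b0 h0.
exists (Num.min 1 (e0 / 2)); split; first by rewrite lt_min ltr01 divr_gt0.
move=> z; rewrite le_min => /andP[z1 ze] /zero_ofP[_].
rewrite dP rootM root_XsubC => /orP[/eqP //|/rootP hz].
have z1' := disc_normc z1.
have le_z0 : Normc.normc z0 <= Normc.normc z0 + 1 by rewrite lerDl.
have small : b * Normc.normc (z - z0) < Normc.normc h.[z0].
  apply: He; apply: le_lt_trans ze _.
  by rewrite ltr_pdivrMr // ltr_pMr // ltr1n.
have := horner_lipschitz h le_z0 z1'.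
by rewrite hz subr0 distcC -/b => /le_lt_trans/(_ small); rewrite ltxx.
Qed.

Lemma cvg_at_right_linear_rate (f : K -> \bar K) (l c e0 : K) : 0 < e0 ->
  (forall e, 0 < e -> e < e0 ->
     ((l - c * e)%:E <= f e <= (l + c * e)%:E)%E) ->
  f e @[e --> 0^'+] --> l%:E.
Proof.
move=> e00 H.
have lin (k : K) : (l + k * e)%:E @[e --> 0^'+] --> l%:E.
  apply: cvg_EFin; first by near=> e.
  rewrite -[X in _ --> X]addr0 -[X in _ + X](mulr0 k).
  apply: cvgD; first exact: cvg_cst.
  by apply: cvgM; [exact: cvg_cst | apply: cvg_at_right_filter; exact: cvg_id].
apply: (squeeze_cvge _ (lin (- c)) (lin c)).
near=> e; rewrite mulNr; apply: H; first by near: e; exact: nbhs_right_gt.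
by near: e; apply: nbhs_right_lt.
Unshelve. all: by end_near.
Qed.

End Limits.

(** * The structured condition number *)

Section Structured.
Context {K : realType}.
Local Notation nc := (@Normc.normc K).
Local Open Scope complex_scope.
Local Open Scope classical_set_scope.

Lemma vnorm2_tr m n (u : 'M[K[i]]_(m, n)) : vnorm2 u^T = vnorm2 u.
Proof.
rewrite /vnorm2 exchange_big; congr Num.sqrt.
by apply: eq_bigr => i _; apply: eq_bigr => j _; rewrite mxE.
Qed.

Lemma quotient_estimate (d e T0 H0 c : K) : 0 < H0 -> 0 < e ->
  `|d * H0 - e * T0| <= c * e ^+ 2 ->
  T0 / H0 - c / H0 * e <= d / e <= T0 / H0 + c / H0 * e.
Proof.
move=> H00 e0 le_c; rewrite -ler_distl.
have eH : 0 < e * H0 by rewrite mulr_gt0.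
have -> : d / e - T0 / H0 = (d * H0 - e * T0) / (e * H0).
  by field; rewrite !gt_eqF.
rewrite normrM [`|_^-1|]gtr0_norm ?invr_gt0 // ler_pdivrMr //.
have -> : c / H0 * e * (e * H0) = c * e ^+ 2 by field; rewrite gt_eqF.
exact: le_c.
Qed.

Section Weighted.
Variables (n p kA kB kC kD : nat).
Variables (a : 'I_kA.+1 -> K) (b : 'I_kB.+1 -> K).
Variables (c : 'I_kC.+1 -> K) (d : 'I_kD.+1 -> K).
Variable z : K[i].
Variables (w1 : 'rV[K[i]]_n) (w2 : 'rV[K[i]]_p).
Variables (v1 : 'cV[K[i]]_n) (v2 : 'cV[K[i]]_p).
Local Notation weight w z := (\sum_i w i * nc z ^+ i).

(** The maximum of |w E(z) v| over the admissible perturbations E of the system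
    matrix, for w = (w1, w2) and v = (v1, v2): each of the four blocks reaches its
    bound independently of the others. *)
Definition structured_sensitivity : K :=
  weight a z * (vnorm2 w1 * vnorm2 v1) + weight b z * (vnorm2 w1 * vnorm2 v2) +
  (weight c z * (vnorm2 w2 * vnorm2 v1) + weight d z * (vnorm2 w2 * vnorm2 v2)).

Lemma sensitivity_ge0 :
  (forall i, 0 <= a i) -> (forall i, 0 <= b i) ->
  (forall i, 0 <= c i) -> (forall i, 0 <= d i) -> 0 <= structured_sensitivity.
Proof.
move=> a0 b0 c0 d0; rewrite !addr_ge0 // mulr_ge0 ?mulr_ge0 ?vnorm2_ge0 //;
  by apply: sumr_ge0 => i _; rewrite mulr_ge0 ?exprn_ge0 ?normc_ge0.
Qed.

Lemma sysmx_bilinear (dA : 'M[{poly K[i]}]_n) (dB : 'M[{poly K[i]}]_(n, p))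
    (dC : 'M[{poly K[i]}]_(p, n)) (dD : 'M[{poly K[i]}]_p) :
  row_mx w1 w2 *m pm_eval (sysmx dA dB dC dD) z *m col_mx v1 v2 =
    (- w1) *m pm_eval dA z *m v1 + w1 *m pm_eval dB z *m v2 +
    (w2 *m pm_eval dC z *m v1 + w2 *m pm_eval dD z *m v2).
Proof.
rewrite pm_eval_sysmx mul_row_block mul_row_col !mulmxDl mulmxN -mulNmx.
by rewrite addrACA.
Qed.

Lemma sensitivity_bound (dA : 'M[{poly K[i]}]_n) (dB : 'M[{poly K[i]}]_(n, p))
    (dC : 'M[{poly K[i]}]_(p, n)) (dD : 'M[{poly K[i]}]_p) :
  admissible a dA -> admissible b dB -> admissible c dC -> admissible d dD ->
  nc ((row_mx w1 w2 *m pm_eval (sysmx dA dB dC dD) z *m col_mx v1 v2) 0 0) <=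
    structured_sensitivity.
Proof.
move=> hA hB hC hD; rewrite sysmx_bilinear.
have add_le (X Y : 'M[K[i]]_1) (s t : K) : nc (X 0 0) <= s -> nc (Y 0 0) <= t ->
    nc ((X + Y) 0 0) <= s + t.
  by move=> Xs Yt; rewrite mxE (le_trans (le_normcD _ _)) ?lerD.
rewrite /structured_sensitivity -(vnorm2N w1).
apply: (add_le); apply: add_le; rewrite ?vnorm2N; try exact: admissible_bilinear.
by rewrite -(vnorm2N w1); apply: admissible_bilinear.
Qed.

Lemma sensitivity_attained :
  (forall i, 0 <= a i) -> (forall i, 0 <= b i) ->
  (forall i, 0 <= c i) -> (forall i, 0 <= d i) ->
  exists dA dB dC dD,
    [/\ admissible a dA, admissible b dB, admissible c dC & admissible d dD] /\
    row_mx w1 w2 *m pm_eval (sysmx dA dB dC dD) z *m col_mx v1 v2 =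
      structured_sensitivity%:C%:M.
Proof.
move=> a0 b0 c0 d0.
have [dA hA EA] := admissible_extremal z (- w1) v1 a0.
have [dB hB EB] := admissible_extremal z w1 v2 b0.
have [dC hC EC] := admissible_extremal z w2 v1 c0.
have [dD hD ED] := admissible_extremal z w2 v2 d0.
exists dA, dB, dC, dD; split=> //; rewrite sysmx_bilinear EA EB EC ED.
by rewrite vnorm2N /structured_sensitivity !rmorphD.
Qed.

Lemma sysmx_entries (Q : {poly K[i]} -> Prop) (dA : 'M[{poly K[i]}]_n)
    (dB : 'M[{poly K[i]}]_(n, p)) (dC : 'M[{poly K[i]}]_(p, n))
    (dD : 'M[{poly K[i]}]_p) :
  (forall i j, Q (- dA i j)) -> (forall i j, Q (dB i j)) ->
  (forall i j, Q (dC i j)) -> (forall i j, Q (dD i j)) ->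
  forall i j, Q (sysmx dA dB dC dD i j).
Proof.
move=> hA hB hC hD i j; rewrite mxE.
by case: fintype.splitP => i' _; rewrite mxE;
   case: fintype.splitP => j' _; rewrite ?mxE.
Qed.

End Weighted.
End Structured.

Theorem corollary4p5 (K : realType) (n p kA kB kC kD : nat)
    (A : 'M[{poly K[i]}]_n) (B : 'M[{poly K[i]}]_(n, p))
    (C : 'M[{poly K[i]}]_(p, n)) (D : 'M[{poly K[i]}]_p)
    (a : 'I_kA.+1 -> K) (b : 'I_kB.+1 -> K)
    (c : 'I_kC.+1 -> K) (d : 'I_kD.+1 -> K)
    (z0 : K[i]) (x y : 'cV[K[i]]_p) (v : 'cV[K[i]]_(n + p))
    (gradeA : has_grade kA A) (gradeB : has_grade kB B)
    (gradeC : has_grade kC C) (gradeD : has_grade kD D)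
    (a_ge0 : forall i, 0 <= a i) (b_ge0 : forall i, 0 <= b i)
    (c_ge0 : forall i, 0 <= c i) (d_ge0 : forall i, 0 <= d i)
    (regA : \det A != 0)
    (regR : regular (transfer A B C D))
    (simple_z0 : simple_zero_of (transfer A B C D) z0)
    (detA_z0 : \det (pm_eval A z0) != 0)
    (eig_x : right_eigenvector (transfer A B C D) z0 x)
    (eig_y : left_eigenvector (transfer A B C D) z0 y)
    (eig_v : right_eigenvector (pm_ratmx (sysmx A B C D)) z0 v) :
  let invA0 := invmx (pm_eval A z0) in
  is_kappaS A B C D a b c d z0 v
    ((Normc.normc ((y^T *m rm_eval (rm_deriv (transfer A B C D)) z0 *m x) 0 0))^-1
     * ((row_mx (vnorm2 (y^T *m pm_eval C z0 *m invA0))%:M (vnorm2 y)%:M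
         *m weight_mx a b c d z0
         *m col_mx (vnorm2 (invA0 *m pm_eval B z0 *m x))%:M (vnorm2 x)%:M)
          : 'M[K]_1) 0 0).
Proof.
move=> invA0; have [x0 Rx] := eig_x; have [y0 yR] := eig_y.
set P := sysmx A B C D.
pose vs := sys_right A B z0 x; pose ws := sys_left A C z0 y.
have Pv : pm_eval P z0 *m vs = 0 by apply: sys_right_ker.
have wP : ws *m pm_eval P z0 = 0 by apply: sys_left_ker.
have vs0 : vs != 0.
  by apply: contraNneq x0 => /(congr1 dsubmx); rewrite col_mxKd linear0 => ->.
have ws0 : ws != 0.
  apply: contraNneq y0 => /(congr1 rsubmx); rewrite row_mxKr linear0 => e.
  by rewrite -[y]trmxK e trmx0.
have [h hz0 dP] : exists2 h, h.[z0] != 0 & \det P = ('X - z0%:P) * h.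
  by apply: simple_zero_sysmx; rewrite -?det_pm_eval.
have [g0 [hE trE]] := simple_eigenvalue_gradient dP hz0 vs0 ws0 Pv wP.
pose phi := structured_sensitivity a b c d z0
  (y^T *m pm_eval C z0 *m invA0) y^T (invA0 *m pm_eval B z0 *m x) x.
pose gam := Normc.normc ((ws *m pm_eval (pm_deriv P) z0 *m vs) 0 0).
set kappa := (X in is_kappaS _ _ _ _ _ _ _ _ _ _ X).
have kappaE : kappa = phi / gam.
  rewrite /kappa (transfer_deriv detA_z0 y Rx) mulrC; congr (_ / _).
  rewrite /weight_mx mul_row_block mul_row_col -!scalar_mxM -!raddfD /=.
  rewrite -!scalar_mxM -raddfD /= mxE eqxx mulr1n.
  by rewrite /phi /structured_sensitivity vnorm2_tr; ring.
split; first exact: isolating_radius_exists dP hz0.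
move=> r iso.
have h0 : 0 < Normc.normc h.[z0] by rewrite normc_gt0.
have r0 : 0 < r by case: iso.
pose rho := Normc.normc z0 + r + 1.
have rho0 : 0 <= rho by rewrite !addr_ge0 ?normc_ge0 // ltW.
have wt_ge0 k (w : 'I_k.+1 -> K) : (forall i, 0 <= w i) ->
    0 <= \sum_i w i * rho ^+ i.
  by move=> w0; apply: sumr_ge0 => i _; rewrite mulr_ge0 ?exprn_ge0.
pose bd := \sum_i a i * rho ^+ i + \sum_i b i * rho ^+ i +
           (\sum_i c i * rho ^+ i + \sum_i d i * rho ^+ i).
have E_bd (dA : 'M[{poly K[i]}]_n) (dB : 'M[{poly K[i]}]_(n, p))
    (dC : 'M[{poly K[i]}]_(p, n)) (dD : 'M[{poly K[i]}]_p) :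
    admissible a dA -> admissible b dB -> admissible c dC ->
    admissible d dD ->
    forall i j, wnorm (@Normc.normc K) rho (sysmx dA dB dC dD i j) <= bd.
  have wa := wt_ge0 _ _ a_ge0; have wb := wt_ge0 _ _ b_ge0.
  have wc := wt_ge0 _ _ c_ge0; have wd := wt_ge0 _ _ d_ge0.
  move=> hA hB hC hD.
  apply: (sysmx_entries
    (Q := fun q => wnorm (@Normc.normc K) rho q <= bd)) => i j /=.
  - rewrite (snN (submultiplicative_wnorm normc_submultiplicative rho0)).
    apply: le_trans (admissible_wnorm i j rho0 hA) _.
    by rewrite /bd -addrA lerDl !addr_ge0.
  - apply: le_trans (admissible_wnorm i j rho0 hB) _.
    by rewrite /bd [_ + \sum_i b i * _]addrC -addrA lerDl !addr_ge0.
  - apply: le_trans (admissible_wnorm i j rho0 hC) _.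
    by rewrite /bd addrC -addrA lerDl !addr_ge0.
  apply: le_trans (admissible_wnorm i j rho0 hD) _.
  by rewrite /bd addrA lerDr !addr_ge0.
have [Cst first_order] := eigenvalue_first_order dP hz0 iso bd.
have hEn : Normc.normc h.[z0] = Normc.normc g0 * gam by rewrite hE Normc.normcM.
have g0_gt0 : 0 < Normc.normc g0.
  rewrite normc_gt0; apply: contraNneq hz0 => g00.
  by rewrite hE g00 mul0r.
pose t E := Normc.normc ((ws *m pm_eval E z0 *m vs) 0 0).
have estimate (dA : 'M[{poly K[i]}]_n) (dB : 'M[{poly K[i]}]_(n, p))
    (dC : 'M[{poly K[i]}]_(p, n)) (dD : 'M[{poly K[i]}]_p) e dz :
    admissible a dA -> admissible b dB ->
    admissible c dC -> admissible d dD -> 0 < e -> e <= 1 ->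
    unique_zero_in_disc (P + (e%:C%C)%:P *: sysmx dA dB dC dD) z0 r (z0 + dz) ->
    t (sysmx dA dB dC dD) / gam - Cst / Normc.normc h.[z0] * e
      <= Normc.normc dz / e
      <= t (sysmx dA dB dC dD) / gam + Cst / Normc.normc h.[z0] * e.
  move=> hA hB hC hD e0 e1 [dzr /zero_ofP[_ rz] _].
  have dzE : z0 + dz - z0 = dz by rewrite addrC addKr.
  have := first_order _ e _ (E_bd _ _ _ _ hA hB hC hD) e0 e1 (ltW dzr) rz.
  (* the factor g0 of the eigenvalue gradient cancels *)
  rewrite dzE => /(quotient_estimate h0 e0).
  suff -> : Normc.normc (\tr (\adj P *m sysmx dA dB dC dD)).[z0] /
      Normc.normc h.[z0] = t (sysmx dA dB dC dD) / gam by [].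
  rewrite trE Normc.normcM hEn -/(t _) invfM mulrACA divff ?mul1r //.
  by rewrite gt_eqF.
have [dA [dB [dC [dD [[hA hB hC hD] ext]]]]] := sensitivity_attained z0
  (y^T *m pm_eval C z0 *m invA0) y^T (invA0 *m pm_eval B z0 *m x) x
  a_ge0 b_ge0 c_ge0 d_ge0.
have [e0 e0_gt0 cont] := eigenvalue_continuation dP hz0 iso (sysmx dA dB dC dD).
apply: (@cvg_at_right_linear_rate _ _ _ (Cst / Normc.normc h.[z0])
                                        (Num.min 1 e0)).
  by rewrite lt_min ltr01.
move=> e e_gt0; rewrite lt_min => /andP[/ltW e1 ee0]; apply/andP; split.
  have [z uz] := cont e e_gt0 ee0.
  have uz' : unique_zero_in_disc (P + (e%:C%C)%:P *: sysmx dA dB dC dD) z0 r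
      (z0 + (z - z0)) by rewrite addrCA subrr addr0.
  have /andP[lo _] := estimate _ _ _ _ _ _ hA hB hC hD e_gt0 e1 uz'.
  have [_ /zero_ofP[_ rz] _] := uz'.
  have [u u0 uP] : exists2 u : 'cV_(n + p), u != 0 &
      pm_eval (P + (e%:C%C)%:P *: sysmx dA dB dC dD) (z0 + (z - z0)) *m u = 0.
    have /det0P[u u0 uP] : \det (pm_eval (P + (e%:C%C)%:P *: sysmx dA dB dC dD)
        (z0 + (z - z0)))^T == 0 by rewrite det_tr det_pm_eval.
    by exists u^T; rewrite ?trmx_eq0 // -[LHS]trmxK trmx_mul trmxK uP trmx0.
  have ec : e%:C%C != 0 by rewrite -normc_gt0 normc_real gtr0_norm.
  apply: le_trans (_ : (Normc.normc (z - z0) / e)%:E <= _)%E.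
    rewrite lee_fin kappaE; move: lo.
    rewrite /t ext mxE eqxx mulr1n normc_real ger0_norm //.
    exact: sensitivity_ge0.
  (* any eigenvector u of the perturbed matrix has the form v + e dv *)
  apply: ereal_sup_ubound.
  exists dA, dB, dC, dD, (z - z0), ((e%:C%C)^-1 *: (u - v)).
  have -> : v + e%:C%C *: ((e%:C%C)^-1 *: (u - v)) = u.
    by rewrite scalerA divff // scale1r addrC subrK.
  by split.
apply: ge_ereal_sup => q [dA' [dB' [dC' [dD' [dz [dv]]]]]].
move=> [[hA' hB' hC' hD'] uz _ _ ->].
have /andP[_ up] := estimate _ _ _ _ _ _ hA' hB' hC' hD' e_gt0 e1 uz.
rewrite lee_fin; apply: le_trans up _; rewrite lerD2r kappaE.
rewrite ler_wpM2r ?invr_ge0 ?normc_ge0 //.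
exact: sensitivity_bound.
Qed.
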